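(* Let $\alpha>-1$, let $\phi(z)=\lambda z$ with $\lambda\ne0$ (so $0<|\lambda|\le1$), and let $\psi(z)=\sum_{k=1}^\infty\hat\psi_kz^k$ be analytic on $\mathbb{D}$ (so $\psi(0)=0$), with $C_{\psi,\phi}$ bounded on $L^2_a(dA_\alpha)$. Then for every integer $m\ge2$, $W(C_{\psi,\phi})$ contains the closed disc centred at the origin with radius $\dfrac12\sqrt{\dfrac{m!\,\Gamma(\alpha+3)}{\Gamma(m+\alpha+2)}}\,|\lambda\hat\psi_{m-1}|$.
   Context: $\mathbb{D}$ is the open unit disc. $L^2_a(dA_\alpha)$ is the weighted Bergman space of analytic $f$ on $\mathbb{D}$ with $\int_{\mathbb{D}}|f|^2dA_\alpha<\infty$, $dA_{\alpha}(z)=(\alpha+1)(1-|z|^2)^{\alpha}dA(z)$, $dA$ normalized area measure. $C_{\psi,\phi}f=\psi\cdot(f\circ\phi)$. $W(T)=\{\langle Tf,f\rangle:\|f\|=1\}$. *)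

(* Defs.v *)
(* R : realType, complex numbers R[i] from real_closed. *)
From HB Require Import structures.
From mathcomp Require Import all_boot all_order all_algebra.
From mathcomp Require Import all_classical all_reals all_analysis.
From mathcomp Require Import complex.
Set Implicit Arguments. Unset Strict Implicit. Unset Printing Implicit Defensive.
Import Order.TTheory GRing.Theory Num.Theory.
Import numFieldNormedType.Exports.
Local Open Scope classical_set_scope.
Local Open Scope ring_scope.
Local Open Scope complex_scope.

Section Defs.
Variable R : realType.

(* Euler's Gamma function, Gamma(x) = \int_0^oo t^(x-1) e^(-t) dt  (x > 0). *)
Definition Gamma (x : R) : R :=
  Rintegral (@lebesgue_measure R) `]0, +oo[%classic
    (fun t : R => t `^ (x - 1) * expR (- t)).

(* modulus of a complex number, as a real number *)
Definition cabs (z : R[i]) : R := Num.sqrt (complex.Re z ^+ 2 + complex.Im z ^+ 2).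

(* points of the plane R*R viewed as complex numbers *)
Definition toC (p : R * R) : R[i] := p.1 +i* p.2.

(* the open unit disc *)
Definition cdisc : set R[i] := [set z | cabs z < 1].
Definition disc2 : set (R * R) := [set p | p.1 ^+ 2 + p.2 ^+ 2 < 1].

(* planar Lebesgue measure dx dy *)
Definition leb2 := ((@lebesgue_measure R) \x (@lebesgue_measure R))%E.

(* density of dA_alpha w.r.t. dx dy on the disc:
   dA_alpha = (alpha+1)(1-|z|^2)^alpha dA,  dA = dx dy / pi *)
Definition wA (alpha : R) (p : R * R) : R :=
  (alpha + 1) * (1 - (p.1 ^+ 2 + p.2 ^+ 2)) `^ alpha / pi.

(* analytic (holomorphic) on the disc: complex differentiable at each point *)
Definition analytic_on_disc (f : R[i] -> R[i]) : Prop :=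
  forall z, z \in cdisc -> derivable (f : R[i]^o -> R[i]^o) z 1.

(* \int_D |f|^2 dA_alpha  (extended real) *)
Definition sqnorm_int (alpha : R) (f : R[i] -> R[i]) : \bar R :=
  (\int[leb2]_(p in disc2) ((cabs (f (toC p))) ^+ 2 * wA alpha p)%:E)%E.

(* membership in the weighted Bergman space L^2_a(dA_alpha) *)
Definition bergman (alpha : R) (f : R[i] -> R[i]) : Prop :=
  analytic_on_disc f /\ (sqnorm_int alpha f < +oo)%E.

(* norm in L^2_a(dA_alpha) *)
Definition bnorm (alpha : R) (f : R[i] -> R[i]) : R :=
  Num.sqrt (fine (sqnorm_int alpha f)).

(* inner product <f, g> = \int_D f conj(g) dA_alpha *)
Definition binner (alpha : R) (f g : R[i] -> R[i]) : R[i] :=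
  (Rintegral leb2 disc2 (fun p => complex.Re (f (toC p) * (g (toC p))^*) * wA alpha p))
  +i* (Rintegral leb2 disc2 (fun p => complex.Im (f (toC p) * (g (toC p))^*) * wA alpha p)).

(* weighted composition operator C_{psi,phi} f = psi * (f o phi) *)
Definition wcomp (psi phi : R[i] -> R[i]) (f : R[i] -> R[i]) : R[i] -> R[i] :=
  fun z => psi z * f (phi z).

(* boundedness of an operator on L^2_a(dA_alpha) *)
Definition bounded_on_bergman (alpha : R) (T : (R[i] -> R[i]) -> (R[i] -> R[i])) : Prop :=
  exists M : R, forall f, bergman alpha f ->
    bergman alpha (T f) /\ bnorm alpha (T f) <= M * bnorm alpha f.

(* numerical range W(T) = { <Tf, f> : f in L^2_a(dA_alpha), ||f|| = 1 } *)
Definition numrange (alpha : R) (T : (R[i] -> R[i]) -> (R[i] -> R[i])) : set R[i] :=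
  [set w | exists f, bergman alpha f /\ bnorm alpha f = 1 /\ binner alpha (T f) f = w].

End Defs.

(* Main.v *)
(** Write e_k for the monomial z^k, N_k for its squared norm, and T for the operator.
  As psi(0) = 0, the power series of T e_1 starts at z^2 and that of T e_m at z^(m+1),
  so among the four products <T e_i, e_j> with i, j in {1, m} only
  <T e_1, e_m> = lambda psihat_(m-1) N_m can be nonzero. Hence f = A e_1 + B e_m has
  <T f, f> = A conj(B) lambda psihat_(m-1) N_m, and under the constraint
  |A|^2 N_1 + |B|^2 N_m = 1 this covers the closed disc of radius
  (1/2) sqrt(N_m / N_1) |lambda psihat_(m-1)|.

  Monomials are orthogonal by rotation invariance of the plane measure (a rotation is
  a product of shears). The law of |z|^2 is uniform, so N_k is a multiple of the
  integral of s^k (1-s)^alpha over [0,1], whence (k+1) N_k = (k+alpha+2) N_(k+1); with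
  Gamma(x+1) = x Gamma(x) this gives the ratio N_m / N_1. *)
Require Import Defs.
From HB Require Import structures.
From mathcomp Require Import all_boot all_order all_algebra.
From mathcomp Require Import all_classical all_reals all_analysis.
From mathcomp Require Import measurable_realfun complex.
From mathcomp Require Import ring lra.
Set Implicit Arguments.
Unset Strict Implicit.
Unset Printing Implicit Defensive.
Import Order.TTheory GRing.Theory Num.Theory.
Import numFieldNormedType.Exports.
Local Open Scope classical_set_scope.
Local Open Scope ring_scope.
Local Open Scope complex_scope.

(** The products <T e_i, e_j> can be read off the coefficients only once the series of psi may be
    integrated term by term. That series converges at each point of the open disc, with no bound up
    to the boundary, and T e_i is known only to be square-integrable. So every product is computed
    first for the weight cut off at |z|^2 < r, where the partial sums are uniformly bounded; then r
    tends to 1 under the dominating function 1 + |T e_i|^2. Boundedness of T enters as this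
    square-integrability.

    Polar coordinates are avoided: the law of |z|^2 is found from the areas of discs and annuli,
    which dilations reduce to the area of the unit disc.

    The factor 1/2 is the maximum of |a| |b| under |a|^2 + |b|^2 = 1, where a and b are the
    coordinates of f in the normalised monomials; every phase is attained as well, hence a full
    disc. *)

Local Notation Re := complex.Re.
Local Notation Im := complex.Im.

(** * Gamma and beta recursions *)

(* An improper fundamental theorem of calculus for F' = f - g: splitting F' into
   two nonnegative parts makes the identity meaningful in [\bar R] without any
   integrability hypothesis. *)
Lemma integral_FTC_balance (R : realType) (D : set R) (a b : nat -> R) (f g F : R -> R)
    (l : R) :
  (forall n, a n < b n) -> nondecreasing_seq (fun n => `[a n, b n]%classic) ->
  \bigcup_n `[a n, b n]%classic = D ->
  (forall x, D x -> 0 <= f x) -> (forall x, D x -> 0 <= g x) ->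
  (forall x, D x -> {for x, continuous f}) -> (forall x, D x -> {for x, continuous g}) ->
  (forall x, D x -> is_derive x 1 F (f x - g x)) ->
  (fun n => F (b n) - F (a n)) @ \oo --> l ->
  (\int[lebesgue_measure]_(x in D) (f x)%:E
    = \int[lebesgue_measure]_(x in D) (g x)%:E + l%:E)%E.
Proof.
move=> ab nd UD f0 g0 cf cg dF Fl.
have sD n : `[a n, b n]%classic `<=` D by rewrite -UD; move=> x abx; exists n.
have mE n (h : R -> R) : (forall x, D x -> {for x, continuous h}) ->
    lebesgue_measure.-integrable `[a n, b n] (EFin \o h).
  move=> ch; apply: continuous_compact_integrable; first exact: segment_compact.
  by apply: continuous_in_subspaceT => x /set_mem /sD; exact: ch.
have cvgE (h : R -> R) : (forall x, D x -> 0 <= h x) -> (forall x, D x -> {for x, continuous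
    h}) ->
    (\int[lebesgue_measure]_(x in `[a n, b n]) (h x)%:E)%E @[n --> \oo] -->
    (\int[lebesgue_measure]_(x in D) (h x)%:E)%E.
  move=> h0 ch; rewrite -UD; apply: ge0_nondecreasing_set_cvg_integral => //.
    by move=> n; have /integrableP[] := mE n h ch.
  by move=> n x abx; rewrite lee_fin; apply: h0; exact: sD abx.
have key n : (\int[lebesgue_measure]_(x in `[a n, b n]) (f x)%:E =
    \int[lebesgue_measure]_(x in `[a n, b n]) (g x)%:E + (F (b n) - F (a n))%:E)%E.
  have cF x : D x -> {for x, continuous F}.
    by move=> /dF dFx; apply/differentiable_continuous/derivable1_diffP; exact: ex_derive.
  have FTC : (\int[lebesgue_measure]_(x in `[a n, b n]) (f x - g x)%:E = (F (b n))%:E - (F (a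
      n))%:E)%E.
    apply: continuous_FTC2 => //.
    - apply: continuous_in_subspaceT => x /set_mem /sD Dx.
      by apply: cvgB; [exact: cf|exact: cg].
    - split.
      + by move=> x /subset_itv_oo_cc /sD Dx; apply: ex_derive; exact: dF.
      + apply: cvg_at_right_filter; apply: cF; apply: (sD n) => /=.
        by rewrite in_itv/= lexx ltW.
      + apply: cvg_at_left_filter; apply: cF; apply: (sD n) => /=.
        by rewrite in_itv/= lexx ltW.
    - move=> x /subset_itv_oo_cc /sD Dx; rewrite derive1E.
      by have [_ ->] := dF _ Dx.
  move: FTC; under eq_integral do rewrite EFinB.
  rewrite integralB//=; [|exact: mE..] => FTC.
  rewrite EFinB -FTC addeCA subee ?adde0//.
  by apply: integrable_fin_num; rewrite //=; exact: mE.
have H1 := cvgE f f0 cf.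
have H2 : (\int[lebesgue_measure]_(x in `[a n, b n]) (f x)%:E)%E @[n --> \oo] -->
    (\int[lebesgue_measure]_(x in D) (g x)%:E + l%:E)%E.
  rewrite (funext key); apply: cvgeD; last 2 first.
  - exact: cvgE.
  - by apply: cvg_EFin => //; exact: nearW.
  (* Since l is finite, the sum of limits is defined even when the integral of g is infinite. *)
  by rewrite fin_num_adde_defl.
exact: cvg_unique H1 H2.
Qed.

(** With an integer N >= x and K = N + 1, exp(y) = exp(y / K)^K >= (y / K)^K, so y^N exp(-y) is at
    most K^K / y. *)
Lemma cvgn_powR_expRN (R : realType) (x : R) : 0 < x ->
  (n.+1%:R `^ x * expR (- n.+1%:R) : R) @[n --> \oo] --> (0 : R).
Proof.
move=> x0; have [N xN] : exists N : nat, x <= N%:R.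
  by exists (Num.bound x); rewrite ltW// archi_boundP// ltW.
pose K := N.+1.
apply: (@squeeze_cvgr _ _ _ _ (fun=> 0) (fun n => K%:R ^+ K * n.+1%:R^-1)).
- apply: nearW => n; rewrite mulr_ge0 ?powR_ge0 ?expR_ge0//=.
  have n1 : 1 <= n.+1%:R :> R by rewrite ler1n.
  apply: (@le_trans _ _ (n.+1%:R ^+ N * expR (- n.+1%:R))).
    by rewrite ler_wpM2r ?expR_ge0// -powR_mulrn// ler_powR.
  have n0 : 0 < n.+1%:R :> R by rewrite ltr0n.
  rewrite expRN ler_pdivrMr ?expR_gt0// mulrAC ler_pdivlMr// -exprSr -/K.
  have -> : n.+1%:R = K%:R * (n.+1%:R / K%:R) :> R by rewrite mulrC divfK ?pnatr_eq0.
  rewrite exprMn ler_wpM2l ?exprn_ge0//.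
  rewrite expRM_natl lerXn2r ?nnegrE ?expR_ge0 ?divr_ge0//.
  by rewrite (le_trans _ (expR_ge1Dx _))// lerDr.
- exact: cvg_cst.
by rewrite -[X in _ --> X](mulr0 (K%:R ^+ K)); apply: cvgM; [exact: cvg_cst|exact:
    cvg_harmonic].
Qed.

(* When the integral diverges both sides are the junk value 0 of [fine +oo]. *)
Lemma Gamma_add1 (R : realType) (x : R) : 0 < x -> Gamma (x + 1) = x * Gamma x.
Proof.
move=> x0; rewrite /Gamma /Rintegral addrK.
pose D : set R := `]0, +oo[%classic.
have Dgt (t : R) : D t -> 0 < t by rewrite /D /= in_itv/= andbT.
have cpow (p t : R) : D t -> {for t, continuous (fun t : R => t `^ p * expR (- t))}.
  move=> /Dgt t0.
  have c1 : {for t, continuous (fun t : R => t `^ p)}.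
    apply/differentiable_continuous/derivable1_diffP.
    by apply: derivable_powR; rewrite in_itv/= t0.
  have c2 : {for t, continuous (fun t : R => expR (- t))}.
    by apply: continuous_comp; [exact: opp_continuous|exact: continuous_expR].
  exact: cvgM c1 c2.
have cpowx (t : R) : D t -> {for t, continuous (fun t : R => x * (t `^ (x - 1) * expR (- t)))}.
  by move=> Dt; apply: cvgM; [exact: cvg_cst|exact: cpow].
rewrite -!/D.
have H : (\int[lebesgue_measure]_(t in D) (x * (t `^ (x - 1) * expR (- t)))%:E =
  \int[lebesgue_measure]_(t in D) (t `^ x * expR (- t))%:E + 0%:E)%E.
  (* Integration by parts in balanced form: t^x e^(-t) has derivative x t^(x-1) e^(-t) - t^x e^(-t)
     and tends to 0 at both ends. The shift by 2 makes the interval [1/(n+2), n+2] nondegenerate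
     already for n = 0. *)
  apply: (@integral_FTC_balance R D (fun n => n.+2%:R^-1) (fun n => n.+2%:R) _ _ (fun t => t `^
      x * expR (- t))).
  - by move=> n; rewrite (@lt_trans _ _ 1)// ?invf_lt1 ?ltr1n.
  - apply/nondecreasing_seqP => n; apply/subsetPset => t /=; rewrite !in_itv/= => /andP[h1 h2].
    apply/andP; split; last by rewrite (le_trans h2)// ler_nat.
    by rewrite (le_trans _ h1)// lef_pV2 ?posrE// ler_nat.
  - apply/seteqP; split => [t [n _ /=]|t /Dgt t0].
      by rewrite /D /= !in_itv/= andbT => /andP[h _]; rewrite (lt_le_trans _ h)// invr_gt0.
    exists (Num.bound t + Num.bound t^-1)%N => //=; rewrite in_itv/=.
    have h1 := archi_boundP (ltW t0).
    have t0' : 0 < t^-1 by rewrite invr_gt0.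
    have h2 := archi_boundP (ltW t0').
    apply/andP; split.
      rewrite -[leRHS]invrK lef_pV2 ?posrE//.
      by rewrite (le_trans (ltW h2))// ler_nat (leq_trans (leq_addl _ _) (leqW (leqnSn _))).
    by rewrite (le_trans (ltW h1))// ler_nat (leq_trans (leq_addr _ _) (leqW (leqnSn _))).
  - by move=> t /Dgt t0; rewrite !mulr_ge0 ?powR_ge0 ?expR_ge0// ltW.
  - by move=> t /Dgt t0; rewrite !mulr_ge0 ?powR_ge0 ?expR_ge0// ltW.
  - exact: cpowx.
  - by move=> t Dt; exact: cpow.
  - move=> t /Dgt t0.
    have d1 := is_derive1_powR x t0.
    have d2 : is_derive t 1 (fun t : R => expR (- t)) (- expR (- t)).
      by apply: is_derive_eq; rewrite mulrN1.
    apply: is_derive_eq.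
    by rewrite /GRing.scale /=; ring.
  - rewrite -[X in _ --> X]subr0; apply: cvgB.
      by have := cvgn_powR_expRN x0; rewrite -cvg_shiftS.
    apply: (@squeeze_cvgr _ _ _ _ (fun=> 0) (fun n => n.+2%:R^-1 `^ x)).
    + by apply: nearW => n; rewrite mulr_ge0 ?powR_ge0 ?expR_ge0//= ler_piMr ?powR_ge0// -expR0
        ler_expR oppr_le0 invr_ge0.
    + exact: cvg_cst.
    have /cvg_at_rightP := powR_cvg0 x0; apply; split; first by move=> n; rewrite invr_gt0.
    by have := @cvg_harmonic R; rewrite -cvg_shiftS.
rewrite adde0 in H; rewrite -H.
under [X in fine X = _]eq_integral do rewrite EFinM.
have mD : measurable (D : set (measurableTypeR R)) by exact: measurable_itv.
rewrite ge0_integralZl//=; last 3 first.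
- apply/measurable_EFinP; apply: open_continuous_measurable_fun => //.
  by move=> t /set_mem Dt; exact: cpow.
- by move=> t _; rewrite lee_fin mulr_ge0 ?powR_ge0 ?expR_ge0.
- exact: ltW.
case: (integral _ _ _) => [r| |] //=; rewrite mulr0.
  by rewrite gt0_muley ?lte_fin.
by rewrite gt0_muleNy ?lte_fin.
Qed.

(** Euler's beta integral B(k + 1, alpha + 1), kept in the extended reals until it is known to be
    finite. *)
Definition beta_moment (R : realType) (alpha : R) (k : nat) : \bar R :=
  (\int[lebesgue_measure]_(s in `]0%R, 1%R[) (s ^+ k * (1 - s) `^ alpha)%:E)%E.

(** The endpoints must be avoided because (1 - s)^alpha may blow up at 1. The shift by 3 is the
    least that makes the interval for n = 0 nondegenerate: a shift by 2 would give the single point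
    1/2. *)
Lemma unit_interval_exhaustion (R : realType) :
  [/\ (forall n, n.+3%:R^-1 < 1 - n.+3%:R^-1 :> R),
  nondecreasing_seq (fun n => `[n.+3%:R^-1, 1 - n.+3%:R^-1 : R]%classic) &
  \bigcup_n `[n.+3%:R^-1, 1 - n.+3%:R^-1]%classic = `]0, 1[%classic :> set R].
Proof.
split.
- move=> n; have : n.+3%:R^-1 <= 3^-1 :> R by rewrite lef_pV2 ?posrE// ler_nat.
  by move: (n.+3%:R^-1) => u; lra.
- apply/nondecreasing_seqP => n; apply/subsetPset => t /=; rewrite !in_itv/= => /andP[h1 h2].
  have : n.+4%:R^-1 <= n.+3%:R^-1 :> R by rewrite lef_pV2 ?posrE// ler_nat.
  move: h1 h2; move: (n.+3%:R^-1) (n.+4%:R^-1) => u v h1 h2 h3.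
  by apply/andP; split; lra.
apply/seteqP; split => [t [n _ /=]|t /=]; rewrite !in_itv/= => /andP[h1 h2].
  have : 0 < n.+3%:R^-1 :> R by rewrite invr_gt0.
  move: h1 h2; move: (n.+3%:R^-1) => u h1 h2 u0.
  by apply/andP; split; lra.
pose r := Order.min t (1 - t); have r0 : 0 < r by rewrite lt_min; apply/andP; split; lra.
have r0' : 0 < r^-1 by rewrite invr_gt0.
have h3 := archi_boundP (ltW r0').
have h4 : (Num.bound r^-1).+3%:R^-1 <= r.
  rewrite -[leRHS]invrK lef_pV2 ?posrE// (le_trans (ltW h3))// ler_nat.
  by rewrite ltnW// ltnW.
exists (Num.bound r^-1) => //=; rewrite in_itv/=.
have : r <= t by rewrite ge_min lexx.
have : r <= 1 - t by rewrite ge_min lexx orbT.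
move: h4; move: (_.+3%:R^-1) => u ? ? ?; by apply/andP; split; lra.
Qed.

Lemma cvgn_inv_add3 (R : realType) : (n.+3%:R^-1 : R) @[n --> \oo] --> (0 : R).
Proof.
have h := @cvg_harmonic R.
have h1 : (n.+2%:R^-1 : R) @[n --> \oo] --> (0 : R) by move: h; rewrite -cvg_shiftS.
by move: h1; rewrite -cvg_shiftS.
Qed.

Lemma cvgn_powR0 (R : realType) (u : nat -> R) (x : R) : 0 < x -> (forall n, 0 < u n) ->
  u n @[n --> \oo] --> 0 -> u n `^ x @[n --> \oo] --> 0.
Proof. by move=> x0 u0 cu; have /cvg_at_rightP := powR_cvg0 x0; apply. Qed.

Lemma is_derive_onem_powR (R : realType) (p s : R) : s < 1 ->
  is_derive s 1 (fun s : R => (1 - s) `^ p) (- (p * (1 - s) `^ (p - 1))).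
Proof.
move=> s1; have s0 : 0 < 1 - s by rewrite subr_gt0.
have d1 := is_derive1_powR p s0.
have d2 : is_derive s 1 (fun s : R => 1 - s) (-1).
  have -> : (fun s : R => 1 - s) = cst 1 - id by [].
  by apply: is_derive_eq; rewrite sub0r.
have -> : (fun s : R => (1 - s) `^ p) = (fun t => t `^ p) \o (fun s => 1 - s) by [].
by have := @is_derive1_comp _ (fun x : R => x `^ p) (fun s : R => 1 - s) s _ _ d1 d2; rewrite
    mulrN1.
Qed.

Lemma continuous_onem_powR (R : realType) (p s : R) : s < 1 ->
  {for s, continuous (fun s : R => (1 - s) `^ p)}.
Proof.
move=> s1; apply/differentiable_continuous/derivable1_diffP; apply: ex_derive.
exact: is_derive_onem_powR.
Qed.

Lemma cvgn_onem_powR (R : realType) (p : R) (u : nat -> R) :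
  u n @[n --> \oo] --> 0 -> (1 - u n) `^ p @[n --> \oo] --> (1 : R).
Proof.
move=> cu; rewrite [X in _ --> X](_ : _ = (1 - 0) `^ p); last by rewrite subr0 powR1.
exact: (cvg_comp u (fun s : R => (1 - s) `^ p) cu (@continuous_onem_powR R p 0 ltr01)).
Qed.

Lemma beta_moment0 (R : realType) (alpha : R) : -1 < alpha ->
  beta_moment alpha 0 = ((alpha + 1)^-1)%:E.
Proof.
move=> a1; have a10 : 0 < alpha + 1 by lra.
have [e1 e2 e3] := unit_interval_exhaustion R.
rewrite /beta_moment.
have Dgt (s : R) : `]0, 1[%classic s -> s < 1 by rewrite /= in_itv/= => /andP[].
have := @integral_FTC_balance R `]0, 1[%classic _ _ (fun s => s ^+ 0 * (1 - s) `^ alpha) (fun=>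
    0)
  (fun s => - ((alpha + 1)^-1 * (1 - s) `^ (alpha + 1))) (alpha + 1)^-1 e1 e2 e3.
rewrite integral0 add0e; apply.
- by move=> s _; rewrite expr0 mul1r powR_ge0.
- by [].
- move=> s /Dgt s1.
  have -> : (fun s : R => s ^+ 0 * (1 - s) `^ alpha) = (fun s => (1 - s) `^ alpha).
    by apply/funext => t; rewrite expr0 mul1r.
  exact: continuous_onem_powR.
- by move=> s _; exact: cst_continuous.
- move=> s /Dgt s1; have d := is_derive_onem_powR (alpha + 1) s1.
  apply: is_derive_eq; rewrite /GRing.scale /= addrK expr0; field; lra.
rewrite [X in _ --> X](_ : _ = - ((alpha + 1)^-1 * 0) - - ((alpha + 1)^-1 * 1)); last by
    rewrite mulr0 mulr1 oppr0 opprK add0r.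
apply: cvgB; apply: cvgN; apply: cvgM; [exact: cvg_cst| |exact: cvg_cst|].
  under eq_fun do rewrite subKr.
  by apply: (cvgn_powR0 a10 _ (@cvgn_inv_add3 R)) => n; rewrite invr_gt0.
exact: cvgn_onem_powR (@cvgn_inv_add3 R).
Qed.

(** The function s^(k+1) (1-s)^(alpha+1) vanishes at 0 and 1. Expanding one factor 1 - s in its
    derivative leaves (k+1) s^k (1-s)^alpha - (k+alpha+2) s^(k+1) (1-s)^alpha. *)
Lemma beta_momentS (R : realType) (alpha : R) (k : nat) : -1 < alpha ->
  ((k.+1%:R)%:E * beta_moment alpha k = (k%:R + alpha + 2)%:E * beta_moment alpha k.+1)%E.
Proof.
move=> a1; have a10 : 0 < alpha + 1 by lra.
have [e1 e2 e3] := unit_interval_exhaustion R.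
have Dlt (s : R) : `]0, 1[%classic s -> 0 < s < 1 by rewrite /= in_itv/=.
have c0 : 0 <= k%:R + alpha + 2 by have := ler0n R k; lra.
have cont (j : nat) (s : R) : `]0, 1[%classic s -> {for s, continuous (fun s : R => s ^+ j * (1
    - s) `^ alpha)}.
  move=> /Dlt/andP[_ s1]; have h1 : {for s, continuous (fun s : R => s ^+ j)} by exact:
      exprn_continuous.
  by apply: cvgM; [exact: h1|exact: continuous_onem_powR].
have mu_ge0 (j : nat) (s : R) : `]0, 1[%classic s -> 0 <= s ^+ j * (1 - s) `^ alpha.
  by move=> /Dlt/andP[s0 s1]; rewrite mulr_ge0 ?powR_ge0// exprn_ge0 ?ltW.
have zE (j : nat) (c : R) : 0 <= c -> (c%:E * beta_moment alpha j =
    \int[lebesgue_measure]_(s in `]0%R, 1%R[) (c * (s ^+ j * (1 - s) `^ alpha))%:E)%E.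
  move=> c0'; under [RHS]eq_integral do rewrite EFinM.
  rewrite ge0_integralZl//.
  - apply/measurable_EFinP; apply: open_continuous_measurable_fun => // s /set_mem.
    exact: cont.
  - by move=> s /(mu_ge0 j); rewrite lee_fin.
rewrite !zE//.
have := @integral_FTC_balance R `]0, 1[%classic _ _ (fun s => k.+1%:R * (s ^+ k * (1 - s) `^
    alpha))
  (fun s => (k%:R + alpha + 2) * (s ^+ k.+1 * (1 - s) `^ alpha))
  (fun s => s ^+ k.+1 * (1 - s) `^ (alpha + 1)) 0 e1 e2 e3.
rewrite adde0; apply.
- by move=> s /(mu_ge0 k); exact: mulr_ge0.
- by move=> s /(mu_ge0 k.+1); exact: mulr_ge0.
- by move=> s /(cont k) h; apply: cvgM h; exact: cvg_cst.
- by move=> s /(cont k.+1) h; apply: cvgM h; exact: cvg_cst.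
- move=> s /Dlt/andP[s0 s1]; have := is_derive_onem_powR (alpha + 1) s1; rewrite addrK => d.
  have dX : is_derive s 1 (fun s : R => s ^+ k.+1) (k.+1%:R * s ^+ k).
    have -> : (fun s : R => s ^+ k.+1) = (@id R) ^+ k.+1 by apply/funext => t; rewrite exprfctE.
    by apply: is_derive_eq; rewrite scaler1.
  have dM := is_deriveM dX d.
  apply: (@is_derive_eq _ _ _ _ _ _ _ _ dM); rewrite /GRing.scale /=.
  have -> : (1 - s) `^ (alpha + 1) = (1 - s) * (1 - s) `^ alpha.
    have s1' : 0 < 1 - s by rewrite subr_gt0.
    by rewrite powRD ?gt_eqF ?implybT// powRr1 ?(ltW s1')// mulrC.
  rewrite -!natr1 !exprS; ring.
rewrite -[X in _ --> X]subr0 -[X in X - _ ](mulr0 (1 ^+ k.+1)) -[X in _ - X](mul0r 1) -[X in X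
    * 1](expr0n R k.+1).
apply: cvgB; apply: cvgM.
- have h : {for (1 : R), continuous (fun s : R => s ^+ k.+1)} by exact: exprn_continuous.
  have cu : (1 - n.+3%:R^-1 : R) @[n --> \oo] --> (1 : R).
    by rewrite -[X in _ --> X]subr0; apply: cvgB; [exact: cvg_cst|exact: cvgn_inv_add3].
  exact: (cvg_comp _ (fun s : R => s ^+ k.+1) cu h).
- under eq_fun do rewrite subKr.
  by apply: (cvgn_powR0 a10 _ (@cvgn_inv_add3 R)) => n; rewrite invr_gt0.
- have h : {for (0 : R), continuous (fun s : R => s ^+ k.+1)} by exact: exprn_continuous.
  exact: (cvg_comp _ (fun s : R => s ^+ k.+1) (@cvgn_inv_add3 R) h).
- exact: cvgn_onem_powR (@cvgn_inv_add3 R).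
Qed.

(** The recursion is an equation between extended reals with finite positive factors, so it carries
    finiteness and positivity from one moment to the next. *)
Lemma beta_moment_fin (R : realType) (alpha : R) (k : nat) : -1 < alpha ->
  exists2 r : R, 0 < r & beta_moment alpha k = r%:E.
Proof.
move=> a1; elim: k => [|k [r r0 rE]].
  by exists (alpha + 1)^-1; [rewrite invr_gt0; lra|exact: beta_moment0].
have c0 : 0 < k%:R + alpha + 2 by have := ler0n R k; lra.
exists (k.+1%:R * r / (k%:R + alpha + 2)); first by rewrite divr_gt0// mulr_gt0.
have := beta_momentS k a1; rewrite rE => H.
have := congr1 (fun z => (((k%:R + alpha + 2)^-1)%:E * z)%E) H.
rewrite muleA [in X in _ = X]muleA -!EFinM mulVf ?gt_eqF// mul1e => <-; congr EFin.
by rewrite -mulrA mulrC.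
Qed.

(** * Planar Lebesgue measure *)

Lemma lebesgue_measure_translation (R : realType) (t : R)
    (A : set (measurableTypeR R)) : measurable A ->
  pushforward lebesgue_measure ((fun x => x + t) : R -> measurableTypeR R) A
    = lebesgue_measure A.
Proof.
move=> mA; have mt : measurable_fun setT (fun x : measurableTypeR R => x + t : measurableTypeR
    R).
  by apply: measurable_funD.
pose f := HB.pack_for {mfun (measurableTypeR R) >-> (measurableTypeR R)}
  (fun x : measurableTypeR R => x + t : measurableTypeR R) (isMeasurableFun.Build _ _ _ _ _ mt).
apply/esym/(@lebesgue_measure_unique R (pushforward lebesgue_measure f)) => //= _ [[a b]] _ <-.
rewrite /pushforward /f /=.
have -> : (fun x => x + t) @^-1` `]a, b]%classic = `](a - t), (b - t)]%classic.
  by apply/seteqP; split => x /=; rewrite !in_itv/= => /andP[? ?]; apply/andP; split; lra.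
rewrite !lebesgue_measure_itv/= !lte_fin ltrD2r.
by case: ifP => // _; rewrite -!EFinB; congr EFin; ring.
Qed.

Lemma lebesgue_measure_dilation (R : realType) (r : R)
    (A : set (measurableTypeR R)) : 0 < r -> measurable A ->
  (r%:E * pushforward lebesgue_measure ((fun x => (x * r)%R) : R -> measurableTypeR R) A
    = lebesgue_measure A)%E.
Proof.
move=> r0 mA; have mt : measurable_fun setT (fun x : measurableTypeR R => x * r :
    measurableTypeR R).
  by apply: measurable_funM.
pose f := HB.pack_for {mfun (measurableTypeR R) >-> (measurableTypeR R)}
  (fun x : measurableTypeR R => x * r : measurableTypeR R) (isMeasurableFun.Build _ _ _ _ _ mt).
pose r' := NngNum (ltW r0).
apply/esym/(@lebesgue_measure_unique R (mscale r' (pushforward lebesgue_measure f))) => //= _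
    [[a b]] _ <-.
rewrite /mscale /= /pushforward /=.
have -> : (fun x => x * r) @^-1` `]a, b]%classic = `](a / r), (b / r)]%classic.
  by apply/seteqP; split => x /=; rewrite !in_itv/= ltr_pdivrMr// ler_pdivlMr.
rewrite !lebesgue_measure_itv/= !lte_fin ltr_pM2r ?invr_gt0//.
case: ifP => // _; last by rewrite mule0.
by rewrite -!EFinB -EFinM; congr EFin; field; rewrite gt_eqF.
Qed.

(** [leb2] unfolds to the integral of the vertical sections; uniqueness of the product measure gives
    access to the horizontal ones, on which a horizontal shear acts as a translation. *)
Lemma leb2_ysection (R : realType) (A : set (R * R)) : measurable A ->
  leb2 A = (\int[@lebesgue_measure R]_y lebesgue_measure (ysection A y))%E.
Proof.
move=> mA.
rewrite /leb2 (@product_measure_unique _ _ _ _ _ _ _ (lebesgue_measure \x^ lebesgue_measure)%E)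
    //.
by move=> B C mB mC; exact: product_measure2E.
Qed.

Lemma leb2_xsection (R : realType) (A : set (R * R)) : 
  leb2 A = (\int[@lebesgue_measure R]_x lebesgue_measure (xsection A x))%E.
Proof. by []. Qed.

Lemma measurable_shearl (R : realType) (t : R) :
  measurable_fun setT (fun p : R * R => (p.1 + t * p.2, p.2)).
Proof.
apply: measurable_fun_pair => /=; last exact: measurable_snd.
apply: measurable_funD => //.
apply: measurable_funM => //.
Qed.

Lemma measurable_shearr (R : realType) (t : R) :
  measurable_fun setT (fun p : R * R => (p.1, p.2 + t * p.1)).
Proof.
apply: measurable_fun_pair => /=; first exact: measurable_fst.
apply: measurable_funD => //.
apply: measurable_funM => //.
Qed.

Lemma leb2_shearl (R : realType) (t : R) (A : set (R * R)) : measurable A ->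
  leb2 ((fun p : R * R => (p.1 + t * p.2, p.2)) @^-1` A) = leb2 A.
Proof.
move=> mA; rewrite !leb2_ysection//; last first.
  by rewrite -[X in measurable X]setTI; apply: measurable_shearl.
apply: eq_integral => y _.
have -> : ysection ((fun p : R * R => (p.1 + t * p.2, p.2)) @^-1` A) y =
    (fun x => x + t * y) @^-1` ysection A y.
  by apply/seteqP; split => x /=; rewrite /ysection/= !inE.
by apply: lebesgue_measure_translation; apply: measurable_ysection.
Qed.

Lemma leb2_shearr (R : realType) (t : R) (A : set (R * R)) : measurable A ->
  leb2 ((fun p : R * R => (p.1, p.2 + t * p.1)) @^-1` A) = leb2 A.
Proof.
move=> mA; rewrite !leb2_xsection//.
apply: eq_integral => y _.
have -> : xsection ((fun p : R * R => (p.1, p.2 + t * p.1)) @^-1` A) y =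
    (fun x => x + t * y) @^-1` xsection A y.
  by apply/seteqP; split => x /=; rewrite /xsection/= !inE.
by apply: lebesgue_measure_translation; apply: measurable_xsection.
Qed.

Definition rot (R : realType) (c s : R) (p : R * R) : R * R :=
  (c * p.1 - s * p.2, s * p.1 + c * p.2).

Lemma measurable_rot (R : realType) (c s : R) : measurable_fun setT (rot c s).
Proof.
apply/measurable_fun_pairP; split => /=.
  by apply: measurable_funB; apply: measurable_funM.
by apply: measurable_funD; apply: measurable_funM.
Qed.

(* A rotation by an angle other than pi is a product of three shears. *)
Lemma leb2_rot (R : realType) (c s : R) (A : set (R * R)) :
  c ^+ 2 + s ^+ 2 = 1 -> c != -1 -> measurable A -> leb2 (rot c s @^-1` A) = leb2 A.
Proof.
move=> cs1 cN1 mA; have c0 : c + 1 != 0 by rewrite addr_eq0.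
(* For c = cos theta and s = sin theta this is - tan (theta / 2), the slope of the two outer shears;
   it is undefined at the excluded angle. *)
pose t := - s / (c + 1).
pose f p : R * R := (p.1 + t * p.2, p.2).
pose g p : R * R := (p.1, p.2 + s * p.1).
have -> : rot c s = f \o g \o f.
  apply/funext => -[x y]; rewrite /rot /f /g /=.
  have s2 : s ^+ 2 = (1 - c) * (c + 1).
    by have -> : s ^+ 2 = 1 - c ^+ 2 by [rewrite -cs1; ring]; ring.
  have e1 : s * t = c - 1 by rewrite /t mulrA mulrN -expr2 s2; field.
  have e2 : t * s = c - 1 by rewrite mulrC.
  have e3 : t * (c + 1) = - s by rewrite /t mulfVK.
  clearbody t.
  rewrite -/t; congr pair.
    transitivity (x + t * y + t * y + (t * s) * (x + t * y)); last by ring.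
    rewrite e2; transitivity (c * x + (t * (c + 1)) * y); last by ring.
    by rewrite e3; ring.
  transitivity (y + s * x + (s * t) * y); last by ring.
  by rewrite e1; ring.
have mf : measurable_fun setT f by exact: measurable_shearl.
have mg : measurable_fun setT g by exact: measurable_shearr.
rewrite !comp_preimage.
rewrite leb2_shearl; last first.
  rewrite -[X in measurable X]setTI; apply: mg => //.
  by rewrite -[X in measurable X]setTI; apply: mf.
rewrite leb2_shearr ?leb2_shearl//.
by rewrite -[X in measurable X]setTI; apply: mf.
Qed.

Definition sqmod (R : realType) (p : R * R) : R := p.1 ^+ 2 + p.2 ^+ 2.

Lemma measurable_sqmod (R : realType) : measurable_fun setT (@sqmod R).
Proof. by apply: measurable_funD; apply: measurable_funX. Qed.

Lemma sqmod_ge0 (R : realType) (p : R * R) : 0 <= sqmod p.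
Proof. by rewrite addr_ge0 ?sqr_ge0. Qed.

Lemma sqmod_rot (R : realType) (c s : R) (p : R * R) : c ^+ 2 + s ^+ 2 = 1 ->
  sqmod (rot c s p) = sqmod p.
Proof.
move=> cs; rewrite /sqmod /rot /=; transitivity ((c ^+ 2 + s ^+ 2) * (p.1 ^+ 2 + p.2 ^+ 2)).
  by ring.
by rewrite cs mul1r.
Qed.

Lemma leb2_dilation (R : realType) (r : R) (A : set (R * R)) : 0 < r -> measurable A ->
  leb2 A = ((r ^+ 2)%:E * leb2 ((fun p : R * R => (p.1 * r, p.2 * r)%R) @^-1` A))%E.
Proof.
move=> r0 mA.
pose g (p : measurableTypeR R * measurableTypeR R) : measurableTypeR R * measurableTypeR R :=
  (p.1 * r, p.2 * r).
have mt : measurable_fun setT g.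
  by apply: measurable_fun_pair => /=; apply: measurable_funM.
pose f := HB.pack_for {mfun (measurableTypeR R * measurableTypeR R)%type >->
  (measurableTypeR R * measurableTypeR R)%type} g (isMeasurableFun.Build _ _ _ _ _ mt).
have r2 : 0 <= r ^+ 2 by rewrite sqr_ge0.
rewrite /leb2 (@product_measure_unique _ _ _ _ _ _ _ (mscale (NngNum r2) (pushforward (@leb2 R)
    f))) //.
move=> B C mB mC; rewrite /= /mscale /= /pushforward /g /=.
have -> : (fun p : R * R => (p.1 * r, p.2 * r)) @^-1` (B `*` C) =
  ((fun x => x * r) @^-1` B) `*` ((fun x => x * r) @^-1` C) by [].
have mr (D : set (measurableTypeR R)) : measurable D -> measurable ((fun x : measurableTypeR R
    => x * r : measurableTypeR R) @^-1` D).
  by move=> mD; rewrite -[X in measurable X]setTI; apply: measurable_funM.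
rewrite product_measure1E; [|exact: mr..].
rewrite -[in RHS](lebesgue_measure_dilation r0 mB) -[in RHS](lebesgue_measure_dilation r0 mC).
by rewrite expr2 EFinM muleACA.
Qed.

Lemma leb2X (R : realType) (A B : set (measurableTypeR R)) : measurable A -> measurable B ->
  leb2 (A `*` B) = (lebesgue_measure A * lebesgue_measure B)%E.
Proof. by move=> mA mB; exact: product_measure1E. Qed.

(* Only ratios of moments matter below, so this is never computed to be pi. *)
Definition unit_area (R : realType) : \bar R := leb2 [set p : R * R | sqmod p <= 1].

Lemma measurable_sqmod_le (R : realType) (b : R) : measurable [set p : R * R | sqmod p <= b].
Proof.
rewrite (_ : [set p : R * R | _] = setT `&` @sqmod R @^-1` `]-oo, b]%classic).
  by apply: measurable_sqmod.
by rewrite setTI; apply/seteqP; split => p /=; rewrite in_itv.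
Qed.

(** The squares [0, 1/2]^2 and [-1, 1]^2 enclose the disc from inside and outside. Finiteness
    permits passing to [fine], and positivity makes all moments positive. *)
Lemma unit_area_bounds (R : realType) : (0 < unit_area R < +oo)%E.
Proof.
apply/andP; split; last first.
  apply: (@le_lt_trans _ _ (leb2 (`[(-1)%R, 1%R]%classic `*` `[(-1)%R, 1%R]%classic : set (R *
      R)))).
    apply: le_measure; rewrite ?inE.
    - exact: measurable_sqmod_le.
    - by apply: measurableX.
    move=> [x y]; rewrite /sqmod /= !in_itv/= => xy.
    by split; apply/andP; split; nra.
  rewrite leb2X//= !lebesgue_measure_itv/= !lte_fin.
  have -> : (-1 < 1 :> R) by lra.
  by rewrite -!EFinD -EFinM ltry.
apply: (@lt_le_trans _ _ (leb2 (`[0%R, 2^-1%R]%classic `*` `[0%R, 2^-1%R]%classic : set (R *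
    R)))).
  rewrite leb2X//= !lebesgue_measure_itv/= !lte_fin invr_gt0 ltr0n.
  by rewrite -!EFinB -EFinM lte_fin subr0 mulr_gt0 ?invr_gt0 ?ltr0n.
apply: le_measure; rewrite ?inE.
- by apply: measurableX.
- exact: measurable_sqmod_le.
move=> [x y]; rewrite /sqmod /= !in_itv/= => -[/andP[x0 x1] /andP[y0 y1]].
have : x <= 1 / 2 by lra.
have : y <= 1 / 2 by lra.
nra.
Qed.

Lemma leb2_sqmod_le (R : realType) (b : R) : 0 <= b ->
  leb2 [set p : R * R | sqmod p <= b] = (b%:E * unit_area R)%E.
Proof.
rewrite le_eqVlt => /predU1P[<-|b0].
  (* A dilation needs a positive ratio, so b = 0 is separate: the disc is then the origin, a product
     of null sets. *)
  rewrite mul0e (_ : [set p : R * R | _] = [set 0] `*` [set 0]).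
    by rewrite leb2X//= lebesgue_measure_set1 mul0e.
  apply/seteqP; split => [[x y]|[x y] [/= -> ->]]; rewrite /sqmod /=.
    by move=> xy; split; apply/eqP; rewrite -sqrf_eq0 eq_le sqr_ge0 andbT; nra.
  by rewrite !expr0n addr0.
set r := Num.sqrt b; have s0 : 0 < r by rewrite sqrtr_gt0.
have r2 : r ^+ 2 = b by rewrite sqr_sqrtr// ltW.
rewrite (leb2_dilation s0); last exact: measurable_sqmod_le.
rewrite r2; congr (_ * leb2 _)%E.
by apply/seteqP; split => [[x y]|[x y]]; rewrite /sqmod /= !exprMn r2 -mulrDl -ler_pdivlMr//
    divff ?gt_eqF.
Qed.

Lemma leb2_sqmod_oc (R : realType) (a b : R) : 0 <= a -> a <= b ->
  leb2 [set p : R * R | a < sqmod p <= b] = ((b - a)%:E * unit_area R)%E.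
Proof.
move=> a0 ab.
have -> : [set p : R * R | a < sqmod p <= b] =
   [set p | sqmod p <= b] `\` [set p | sqmod p <= a].
  apply/seteqP; split => p /=; first by move=> /andP[ap pb]; split => //; apply/negP; rewrite
      -ltNge.
  by move=> [-> /negP]; rewrite -ltNge => ->.
have /andP[u0 uoo] := unit_area_bounds R.
have ufin : unit_area R \is a fin_num by rewrite ge0_fin_numE// ltW.
set X := [set p | sqmod p <= b]; set Y := [set p | sqmod p <= a].
have -> : leb2 (X `\` Y) = (leb2 X - leb2 (X `&` Y))%E.
  apply: (measureD (mu := @leb2 R)); [exact: measurable_sqmod_le|exact: measurable_sqmod_le|].
  suff : (leb2 X < +oo)%E by [].
  by rewrite leb2_sqmod_le ?(le_trans a0)// -(fineK ufin) -EFinM ltry.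
rewrite setIidr; last by move=> p /= /le_trans; apply.
by rewrite /X /Y !leb2_sqmod_le ?(le_trans a0)// -(fineK ufin) -!EFinM -EFinB mulrBl.
Qed.

(* Both sides agree on intervals, because by dilation the disc of radius sqrt b
   has b times the area of the unit disc. *)
Lemma leb2_sqmod (R : realType) (A : set (measurableTypeR R)) : measurable A ->
  leb2 (@sqmod R @^-1` A) = (unit_area R * lebesgue_measure (A `&` (`[0%R, +oo[%classic : set
      R)))%E.
Proof.
move=> mA; have /andP[u0 uoo] := unit_area_bounds R.
have ufin : unit_area R \is a fin_num by rewrite ge0_fin_numE// ltW.
have u0' : 0 <= fine (unit_area R) by rewrite fine_ge0// ltW.
pose g (p : measurableTypeR R * measurableTypeR R) : measurableTypeR R := sqmod p.
have mg : measurable_fun setT g by exact: measurable_sqmod.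
have m0 : measurable ((`[0%R, +oo[%classic : set R) : set (measurableTypeR R)) by [].
have gE (a b : R) : pushforward (@leb2 R) g `]a, b]%classic = leb2 [set p : R * R | a < sqmod p
    <= b].
  by rewrite /pushforward; congr leb2; apply/seteqP; split => p /=; rewrite in_itv.
suff : pushforward (@leb2 R) g A = mscale (NngNum u0') (mrestr lebesgue_measure m0) A.
  by rewrite /= /mscale /= /mrestr /= fineK.
pose mu1 : {measure set (measurableTypeR R) -> \bar R} := pushforward (@leb2 R) g.
pose mu2 : {measure set (measurableTypeR R) -> \bar R} := mscale (NngNum u0') (mrestr
    lebesgue_measure m0).
have := @measure_unique _ R (measurableTypeR R) (@ocitv R) (fun n => `](- n%:R), n%:R]%classic)
    _ _ _ _
  (mu1 mg) mu2 _ _ A mA.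
apply => //.
- exact: ocitvI.
- by move=> n; exact: is_ocitv.
- apply/seteqP; split => // x _; have [n xn] : exists n : nat, `|x : R| < n%:R.
    by exists (Num.bound `|x : R|); rewrite archi_boundP.
  exists n => //=; rewrite in_itv/=; move: xn; rewrite ltr_norml => /andP[-> /ltW].
  by [].
- move=> _ /ocitvP[->|[[a b] /= ab ->]]; first by rewrite !measure0.
  rewrite gE /= /mscale /= /mrestr /= fineK//.
  (* According to the position of ]a, b] relative to 0, the preimage is empty, a full disc or an
     annulus. *)
  have [b0|b0] := ltP b 0.
    rewrite (_ : [set p : R * R | _] = set0) ?measure0; last first.
      by apply/seteqP; split => p //= /andP[_ pb]; have := sqmod_ge0 p; lra.
    rewrite (_ : _ `&` _ = set0) ?measure0 ?mule0//.
    apply/seteqP; split => // => p; rewrite /= !in_itv/= andbT => -[/andP[_ pb] p0].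
    by have := le_lt_trans (le_trans p0 pb) b0; rewrite ltxx.
  have [a0|a0] := ltP a 0.
    rewrite (_ : [set p : R * R | _] = [set p : R * R | sqmod p <= b]); last first.
      by apply/seteqP; split => p //=; [case/andP|move=> ->; rewrite (lt_le_trans a0)
          ?sqmod_ge0].
    rewrite leb2_sqmod_le// (_ : _ `&` _ = `[0, b]%classic); last first.
      apply/seteqP; split => [p|p]; rewrite /= !in_itv/= ?andbT; first by case=> /andP[_ ->] ->.
      by move=> /andP[p0 ->]; rewrite (lt_le_trans a0).
    rewrite lebesgue_measure_itv/= lte_fin; case: ltP => b0'.
      by rewrite sube0 muleC.
    by rewrite (_ : b = 0) ?mul0e ?mule0//; apply/le_anti/andP.
  rewrite leb2_sqmod_oc ?(ltW ab)// (_ : _ `&` _ = `]a, b]%classic); last first.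
    apply/seteqP; split => [p|p]; rewrite /= !in_itv/= ?andbT; first by case.
    by move=> /andP[ap ->]; rewrite ap; split => //; rewrite (le_trans a0)// ltW.
  by rewrite lebesgue_measure_itv/= lte_fin ab muleC.
- move=> n; have -> : mu1 mg _ = leb2 [set p : R * R | - n%:R < sqmod p <= n%:R] := gE _ _.
  apply: (@le_lt_trans _ _ (leb2 [set p : R * R | sqmod p <= n%:R])).
    apply: le_measure; rewrite ?inE.
    + rewrite (_ : [set p : R * R | _] = setT `&` @sqmod R @^-1` `](- n%:R), n%:R]%classic).
        by apply: measurable_sqmod.
      by rewrite setTI; apply/seteqP; split => p /=; rewrite in_itv.
    + exact: measurable_sqmod_le.
    + by move=> p /= /andP[].
  by rewrite leb2_sqmod_le// -(fineK ufin) -EFinM ltry.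
Qed.

(** * Complex-valued integrals over the disc *)

Lemma cabsM (R : realType) (z w : R[i]) : cabs (z * w) = cabs z * cabs w.
Proof. by case: z w => a b [c d]; exact: (Normc.normcM (a +i* b) (c +i* d)). Qed.

Lemma cabsD (R : realType) (z w : R[i]) : cabs (z + w) <= cabs z + cabs w.
Proof. by case: z w => a b [c d]; exact: (@le_normcD R (a +i* b) (c +i* d)). Qed.

Lemma cabs_ge0 (R : realType) (z : R[i]) : 0 <= cabs z.
Proof. exact: sqrtr_ge0. Qed.

Lemma cabs0 (R : realType) : cabs (0 : R[i]) = 0.
Proof. by rewrite /cabs /= expr0n addr0 sqrtr0. Qed.

Lemma cabs_eq0 (R : realType) (z : R[i]) : cabs z = 0 -> z = 0.
Proof. by case: z => a b; exact: (@Normc.eq0_normc R (a +i* b)). Qed.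

Lemma cabs1 (R : realType) : cabs (1 : R[i]) = 1.
Proof. by rewrite /cabs /= expr0n addr0 expr1n sqrtr1. Qed.

Lemma cabsX (R : realType) (z : R[i]) n : cabs (z ^+ n) = cabs z ^+ n.
Proof. by elim: n => [|n IH]; rewrite ?expr0 ?cabs1// !exprS cabsM IH. Qed.

Lemma cabs_conjc (R : realType) (z : R[i]) : cabs (z^*) = cabs z.
Proof. by case: z => a b; rewrite /cabs /= sqrrN. Qed.

Lemma cabs_real (R : realType) (x : R) : 0 <= x -> cabs (x%:C) = x.
Proof. by move=> x0; rewrite /cabs /= expr0n addr0 sqrtr_sqr ger0_norm. Qed.

Lemma sqr_cabs (R : realType) (z : R[i]) : cabs z ^+ 2 = Re z ^+ 2 + Im z ^+ 2.
Proof. by rewrite sqr_sqrtr// addr_ge0 ?sqr_ge0. Qed.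

(* As an argument of [*], the notation [z^*] is parsed in [ring_scope], as the
   conjugation of the closed field [R[i]]; it is convertible to [conjc z]. *)
Lemma mulc_conjc (R : realType) (z : R[i]) : z * z^* = (cabs z ^+ 2)%:C.
Proof.
rewrite sqr_cabs; case: z => a b /=; apply/eqP; rewrite eq_complex /=.
by apply/andP; split; apply/eqP; ring.
Qed.

Lemma cabs_toC (R : realType) (p : R * R) : cabs (toC p) ^+ 2 = sqmod p.
Proof. by rewrite sqr_cabs. Qed.

Lemma normr_Re_le (R : realType) (z : R[i]) : `|Re z| <= cabs z.
Proof. by rewrite -sqrtr_sqr ler_wsqrtr// lerDl sqr_ge0. Qed.

Lemma normr_Im_le (R : realType) (z : R[i]) : `|Im z| <= cabs z.
Proof. by rewrite -sqrtr_sqr ler_wsqrtr// lerDr sqr_ge0. Qed.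

Lemma cabs_le (R : realType) (z : R[i]) : cabs z <= `|Re z| + `|Im z|.
Proof.
rewrite -[leRHS]ger0_norm ?addr_ge0// -sqrtr_sqr ler_wsqrtr// sqrrD !real_normK ?num_real//.
by rewrite lerD2r lerDl mulrn_wge0// mulr_ge0.
Qed.

Lemma ReM (R : realType) (z w : R[i]) : Re (z * w) = Re z * Re w - Im z * Im w.
Proof. by case: z w => a b [c d]. Qed.

Lemma ImM (R : realType) (z w : R[i]) : Im (z * w) = Re z * Im w + Im z * Re w.
Proof. by case: z w => a b [c d]. Qed.

Lemma ReD (R : realType) (z w : R[i]) : Re (z + w) = Re z + Re w.
Proof. by case: z w => a b [c d]. Qed.

Lemma ImD (R : realType) (z w : R[i]) : Im (z + w) = Im z + Im w.
Proof. by case: z w => a b [c d]. Qed.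

Lemma complex_eqP (R : realType) (z w : R[i]) : Re z = Re w -> Im z = Im w -> z = w.
Proof. by case: z w => a b [c d] /= -> ->. Qed.

Lemma Re_sum (R : realType) (I : Type) (r : seq I) (P : pred I) (F : I -> R[i]) :
  Re (\sum_(i <- r | P i) F i) = \sum_(i <- r | P i) Re (F i).
Proof. by apply: (big_morph (@Re R) (@ReD R)). Qed.

Lemma Im_sum (R : realType) (I : Type) (r : seq I) (P : pred I) (F : I -> R[i]) :
  Im (\sum_(i <- r | P i) F i) = \sum_(i <- r | P i) Im (F i).
Proof. by apply: (big_morph (@Im R) (@ImD R)). Qed.

Lemma cvgC_parts (R : realType) (u : nat -> R[i]) (l : R[i]) :
  (u : nat -> R[i]^o) @ \oo --> (l : R[i]^o) ->
  (Re (u n) @[n --> \oo] --> Re l) /\ (Im (u n) @[n --> \oo] --> Im l).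
Proof.
move=> /cvgrPdist_lt ul.
(* The norm of [R[i]] takes its values in [R[i]], so a real tolerance has to be embedded there
   before the hypothesis applies. *)
have key (e : R) : 0 < e -> \forall n \near \oo, cabs (l - u n) < e.
  move=> e0; have e0' : 0 < (e%:C : R[i]) by rewrite ltcR.
  have := ul _ e0'; apply: filterS => n.
  by rewrite normc_def ltcR.
split; apply/cvgrPdist_lt => e e0; have := key _ e0; apply: filterS => n; apply: le_lt_trans.
  by rewrite (_ : _ - _ = Re (l - u n)) ?normr_Re_le//; case: (l) (u n) => a b [c d].
by rewrite (_ : _ - _ = Im (l - u n)) ?normr_Im_le//; case: (l) (u n) => a b [c d].
Qed.

Lemma measurable_disc2 (R : realType) : measurable (@disc2 R).
Proof.
rewrite (_ : @disc2 R = setT `&` @sqmod R @^-1` `]-oo, 1[%classic).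
  by apply: measurable_sqmod.
by rewrite setTI; apply/seteqP; split => p /=; rewrite in_itv.
Qed.

Definition disc_Rintegral (R : realType) (f : R * R -> R) : R := Rintegral (@leb2 R) (@disc2 R)
    f.

Definition disc_Rintegrable (R : realType) (f : R * R -> R) : Prop :=
  (@leb2 R).-integrable (@disc2 R) (EFin \o f).

Lemma eq_disc_Rintegral (R : realType) (f g : R * R -> R) : (forall p, disc2 p -> f p = g p) ->
  disc_Rintegral f = disc_Rintegral g.
Proof. by move=> fg; apply: eq_Rintegral => p /set_mem; exact: fg. Qed.

Lemma eq_disc_Rintegrable (R : realType) (f g : R * R -> R) : (forall p, disc2 p -> f p = g p)
    ->
  disc_Rintegrable f -> disc_Rintegrable g.
Proof.
move=> fg; apply: eq_integrable; first exact: measurable_disc2.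
by move=> p /set_mem Dp /=; rewrite fg.
Qed.

Lemma disc_Rintegrable_le (R : realType) (f g : R * R -> R) : measurable_fun (@disc2 R) f ->
  (forall p, disc2 p -> `|f p| <= g p) -> disc_Rintegrable g -> disc_Rintegrable f.
Proof.
move=> mf fg; apply: le_integrable; [exact: measurable_disc2|exact/measurable_EFinP|].
by move=> p Dp /=; rewrite lee_fin (le_trans (fg p Dp))// ler_norm.
Qed.

Lemma disc_Rintegral_lin (R : realType) (a b : R) (f g : R * R -> R) :
  disc_Rintegrable f -> disc_Rintegrable g ->
  disc_Rintegrable (fun p => a * f p + b * g p) /\
  disc_Rintegral (fun p => a * f p + b * g p) = a * disc_Rintegral f + b * disc_Rintegral g.
Proof.
move=> fi gi; have mD := @measurable_disc2 R.
have afi : disc_Rintegrable (fun p => a * f p).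
  have := @integrableZl _ _ _ (@leb2 R) _ mD a _ fi.
  by apply: eq_integrable => // p _.
have bgi : disc_Rintegrable (fun p => b * g p).
  have := @integrableZl _ _ _ (@leb2 R) _ mD b _ gi.
  by apply: eq_integrable => // p _.
split.
  have := @integrableD _ _ _ (@leb2 R) _ mD _ _ afi bgi.
  by apply: eq_integrable => // p _.
have e1 : disc_Rintegral (fun p => a * f p) = a * disc_Rintegral f := @RintegralZl _ _ _ (@leb2
    R) _ f a mD fi.
have e2 : disc_Rintegral (fun p => b * g p) = b * disc_Rintegral g := @RintegralZl _ _ _ (@leb2
    R) _ g b mD gi.
by rewrite -e1 -e2; exact: (@RintegralD _ _ _ (@leb2 R) _ _ _ mD afi bgi).
Qed.

Lemma disc_Rintegral_dominated (R : realType) (f_ : nat -> R * R -> R) (f g : R * R -> R) :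
  (forall n, measurable_fun (@disc2 R) (f_ n)) ->
  (forall p, disc2 p -> f_ n p @[n --> \oo] --> f p) ->
  (forall n p, disc2 p -> `|f_ n p| <= g p) -> disc_Rintegrable g ->
  disc_Rintegrable f /\ (disc_Rintegral (f_ n) @[n --> \oo] --> disc_Rintegral f).
Proof.
move=> mf ff fg gi; have mD := @measurable_disc2 R.
have mf' n : measurable_fun (@disc2 R) (EFin \o f_ n) by apply/measurable_EFinP.
have ff' p : disc2 p -> (EFin \o f_ n) p @[n --> \oo] --> (EFin \o f) p.
  by move=> /ff; apply: cvg_EFin; exact: nearW.
have mfl : measurable_fun (@disc2 R) (EFin \o f) := emeasurable_fun_cvg _ _ mf' ff'.
have aff : {ae @leb2 R, forall p, disc2 p -> (EFin \o f_ n) p @[n --> \oo] --> (EFin \o f) p}.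
  by apply: aeW => p; exact: ff'.
have afg : {ae @leb2 R, forall p n, disc2 p -> (`|(EFin \o f_ n) p| <= (EFin \o g) p)%E}.
  by apply: aeW => p n Dp; rewrite lee_fin fg.
have [fi _ cv] := @dominated_convergence _ _ _ (@leb2 R) _ mD (fun n => EFin \o f_ n) (EFin \o
    f) (EFin \o g)
  mf' mfl aff gi afg.
split => //.
by apply: fine_cvg; rewrite fineK ?integrable_fin_num.
Qed.

(** This takes the place of polar coordinates: the image of [leb2] under [sqmod] is a multiple of
    Lebesgue measure on the half-line, and the disc is the preimage of [0, 1[. *)
Lemma integral_sqmod (R : realType) (k : R -> R) :
  measurable_fun (setT : set R) k -> (forall s, 0 <= s < 1 -> 0 <= k s) ->
  (\int[@leb2 R]_(p in @disc2 R) (k (sqmod p))%:E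
    = unit_area R * \int[lebesgue_measure]_(s in `[0%R, 1%R[) (k s)%:E)%E.
Proof.
move=> mk k0; pose D : set R := `[0, 1[%classic.
have mD : measurable (D : set (measurableTypeR R)) by exact: measurable_itv.
have DE : @disc2 R = @sqmod R @^-1` D.
  by apply/seteqP; split => p /=; rewrite /D /= in_itv/= sqmod_ge0.
have /andP[u0 uoo] := unit_area_bounds R.
have ufin : unit_area R \is a fin_num by rewrite ge0_fin_numE// ltW.
have u0' : 0 <= fine (unit_area R) by rewrite fine_ge0// ltW.
pose g (p : measurableTypeR R * measurableTypeR R) : measurableTypeR R := sqmod p.
have mg : measurable_fun setT g by exact: measurable_sqmod.
have mkD : measurable_fun (D : set (measurableTypeR R)) (EFin \o k).
  by apply/measurable_EFinP; exact: measurable_funTS.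
have kD0 (s : measurableTypeR R) : D s -> (0 <= (EFin \o k) s)%E.
  by rewrite /D /= in_itv/= lee_fin; exact: k0.
have := @ge0_integral_pushforward _ _ _ _ R g mg (@leb2 R) D (EFin \o k) mD mkD.
rewrite -[g @^-1` D]/(@sqmod R @^-1` D) -DE => <-; last by move=> s /set_mem /kD0.
rewrite -[X in (X * _)%E](fineK ufin) -(@ge0_integral_mscale _ _ _ lebesgue_measure D mD
    (NngNum u0') _ mkD kD0).
apply: eq_measure_integral => A mA AD.
change (leb2 (@sqmod R @^-1` A) = (fine (unit_area R))%:E * lebesgue_measure A)%E.
rewrite fineK// leb2_sqmod//; congr (_ * lebesgue_measure _)%E.
by apply/seteqP; split => s /=; [case|move=> As; split => //; move: (AD _ As); rewrite /D /=
    !in_itv/= => /andP[->]].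
Qed.

(* [h] is the density as a function of the squared modulus, so that these
   integrals are against the radial measure h(|z|^2) dx dy. *)
Definition disc_integrable (R : realType) (h : R -> R) (F : R * R -> R[i]) : Prop :=
  disc_Rintegrable (fun p => Re (F p) * h (sqmod p)) /\
  disc_Rintegrable (fun p => Im (F p) * h (sqmod p)).

Definition disc_integral (R : realType) (h : R -> R) (F : R * R -> R[i]) : R[i] :=
  disc_Rintegral (fun p => Re (F p) * h (sqmod p)) +i*
  disc_Rintegral (fun p => Im (F p) * h (sqmod p)).

Lemma eq_disc_integrable (R : realType) (h : R -> R) (F G : R * R -> R[i]) :
  (forall p, disc2 p -> F p = G p) -> disc_integrable h F -> disc_integrable h G.
Proof.
move=> FG [F1 F2]; split; [apply: eq_disc_Rintegrable F1|apply: eq_disc_Rintegrable F2] => p Dp;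
  by rewrite FG.
Qed.

Lemma eq_disc_integral (R : realType) (h : R -> R) (F G : R * R -> R[i]) :
  (forall p, disc2 p -> F p = G p) -> disc_integral h F = disc_integral h G.
Proof. by move=> FG; rewrite /disc_integral; congr Complex; apply: eq_disc_Rintegral => p Dp;
    rewrite FG. Qed.

Lemma disc_integral_linear (R : realType) (h : R -> R) (c : R[i]) (F G : R * R -> R[i]) :
  disc_integrable h F -> disc_integrable h G -> disc_integrable h (fun p => c * F p + G p) /\
  disc_integral h (fun p => c * F p + G p) = c * disc_integral h F + disc_integral h G.
Proof.
case: c => a b [F1 F2] [G1 G2].
have [r1 e1] := disc_Rintegral_lin a (- b) F1 F2; have [r2 e2] := disc_Rintegral_lin 1 1 r1 G1.
have [i1 f1] := disc_Rintegral_lin a b F2 F1; have [i2 f2] := disc_Rintegral_lin 1 1 i1 G2.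
split.
  by split; [apply: eq_disc_Rintegrable r2|apply: eq_disc_Rintegrable i2] => p _;
    rewrite ?(ReD, ReM, ImD, ImM) /=; ring.
apply: complex_eqP; rewrite ?(ReD, ReM, ImD, ImM) /=.
  rewrite mulNr !mul1r in e1 e2; rewrite -e1 -e2; apply: eq_disc_Rintegral => p _.
  by rewrite ?(ReD, ReM, ImD, ImM) /=; ring.
rewrite !mul1r in f1 f2; rewrite -f1 -f2; apply: eq_disc_Rintegral => p _.
by rewrite ?(ReD, ReM, ImD, ImM) /=; ring.
Qed.

Lemma disc_integrable0 (R : realType) (h : R -> R) : disc_integrable h (fun=> 0).
Proof.
have i0 : disc_Rintegrable (fun=> 0 : R) by exact: integrable0.
by split; apply: eq_disc_Rintegrable i0 => p _; rewrite mul0r.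
Qed.

Lemma disc_integral0 (R : realType) (h : R -> R) : disc_integral h (fun=> 0) = 0.
Proof.
by apply: complex_eqP => /=; rewrite /disc_Rintegral /Rintegral; under eq_integral do rewrite
    mul0r;
  rewrite integral0.
Qed.

Lemma disc_integral_scale (R : realType) (h : R -> R) (c : R[i]) (F : R * R -> R[i]) :
  disc_integrable h F -> disc_integrable h (fun p => c * F p) /\ disc_integral h (fun p => c *
      F p) = c * disc_integral h F.
Proof.
move=> iF; have [H1 H2] := disc_integral_linear c iF (disc_integrable0 h); split.
  by apply: eq_disc_integrable H1 => p _; rewrite addr0.
by rewrite -[RHS]addr0 -[X in _ + X](disc_integral0 h) -H2; apply: eq_disc_integral => p _;
    rewrite addr0.
Qed.

Lemma disc_integral_add (R : realType) (h : R -> R) (F G : R * R -> R[i]) :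
  disc_integrable h F -> disc_integrable h G -> disc_integrable h (fun p => F p + G p) /\
  disc_integral h (fun p => F p + G p) = disc_integral h F + disc_integral h G.
Proof.
move=> iF iG; have [H1 H2] := disc_integral_linear 1 iF iG; split.
  by apply: eq_disc_integrable H1 => p _; rewrite mul1r.
by rewrite -[X in X + _]mul1r -H2; apply: eq_disc_integral => p _; rewrite mul1r.
Qed.

Lemma disc_integral_sum (R : realType) (h : R -> R) n (F : nat -> R * R -> R[i]) :
  (forall k, disc_integrable h (F k)) -> disc_integrable h (fun p => \sum_(0 <= k < n) F k p) /\
  disc_integral h (fun p => \sum_(0 <= k < n) F k p) = \sum_(0 <= k < n) disc_integral h (F k).
Proof.
move=> iF; elim: n => [|n [IH1 IH2]].
  split; first by apply: eq_disc_integrable (disc_integrable0 h) => p _; rewrite big_nil.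
  rewrite big_nil; transitivity (disc_integral h (fun=> 0)); last exact: disc_integral0.
  by apply: eq_disc_integral => p _; rewrite big_nil.
have [H1 H2] := disc_integral_add IH1 (iF n); split.
  by apply: eq_disc_integrable H1 => p _; rewrite big_nat_recr.
by rewrite big_nat_recr//= -IH2 -H2; apply: eq_disc_integral => p _; rewrite big_nat_recr.
Qed.

Lemma disc_integral_dominated (R : realType) (h : R -> R) (F_ : nat -> R * R -> R[i]) (F : R *
    R -> R[i])
    (G : R * R -> R) :
  measurable_fun setT h -> (forall s, 0 <= s < 1 -> 0 <= h s) ->
  (forall n, measurable_fun (@disc2 R) (fun p => Re (F_ n p)) /\ measurable_fun (@disc2 R) (fun
      p => Im (F_ n p))) ->
  (forall p, disc2 p -> Re (F_ n p) @[n --> \oo] --> Re (F p)) ->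
  (forall p, disc2 p -> Im (F_ n p) @[n --> \oo] --> Im (F p)) ->
  (forall n p, disc2 p -> cabs (F_ n p) * h (sqmod p) <= G p * h (sqmod p)) ->
  disc_Rintegrable (fun p => G p * h (sqmod p)) ->
  [/\ disc_integrable h F, Re (disc_integral h (F_ n)) @[n --> \oo] --> Re (disc_integral h F) &
    Im (disc_integral h (F_ n)) @[n --> \oo] --> Im (disc_integral h F)].
Proof.
move=> mh h0 mF cR cIm FG iG.
have mhD : measurable_fun (@disc2 R) (h \o @sqmod R).
  apply: measurable_funTS; apply: measurableT_comp => //; exact: measurable_sqmod.
have hD (p : R * R) : disc2 p -> 0 <= h (sqmod p).
  by move=> Dp; apply: h0; rewrite sqmod_ge0.
(* The domination term is the chain |Re (F_n) h| = |Re (F_n)| h <= |F_n| h <= G h, valid because h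
   is nonnegative on [0, 1[. *)
have [i1 c1] := @disc_Rintegral_dominated R (fun n p => Re (F_ n p) * h (sqmod p))
  (fun p => Re (F p) * h (sqmod p)) (fun p => G p * h (sqmod p))
  (fun n => measurable_funM (mF n).1 mhD) (fun p Dp => cvgM (cR p Dp) (cvg_cst _))
  (fun n p Dp => le_trans (eq_ind_r (fun x => x <= _)
    (ler_wpM2r (hD p Dp) (normr_Re_le _))
    (etrans (normrM _ _) (congr1 _ (ger0_norm (hD p Dp))))) (FG n p Dp)) iG.
have [i2 c2] := @disc_Rintegral_dominated R (fun n p => Im (F_ n p) * h (sqmod p))
  (fun p => Im (F p) * h (sqmod p)) (fun p => G p * h (sqmod p))
  (fun n => measurable_funM (mF n).2 mhD) (fun p Dp => cvgM (cIm p Dp) (cvg_cst _))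
  (fun n p Dp => le_trans (eq_ind_r (fun x => x <= _)
    (ler_wpM2r (hD p Dp) (normr_Im_le _))
    (etrans (normrM _ _) (congr1 _ (ger0_norm (hD p Dp))))) (FG n p Dp)) iG.
by [].
Qed.

(** * Rotation invariance and orthogonality of monomials *)

Definition cmeasurable (R : realType) (F : R * R -> R[i]) : Prop :=
  measurable_fun setT (fun p => Re (F p)) /\ measurable_fun setT (fun p => Im (F p)).

Lemma cmeasurableM (R : realType) (F G : R * R -> R[i]) : cmeasurable F -> cmeasurable G ->
  cmeasurable (fun p => F p * G p).
Proof.
move=> [F1 F2] [G1 G2]; split.
  under eq_fun do rewrite ReM.
  by apply: measurable_funB; apply: measurable_funM.
under eq_fun do rewrite ImM.
by apply: measurable_funD; apply: measurable_funM.
Qed.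

Lemma cmeasurable_cst (R : realType) (c : R[i]) : cmeasurable (fun=> c).
Proof. by split; exact: measurable_cst. Qed.

Lemma cmeasurable_toC (R : realType) : cmeasurable (@toC R).
Proof. by split; [exact: measurable_fst|exact: measurable_snd]. Qed.

Lemma cmeasurable_conjc (R : realType) (F : R * R -> R[i]) : cmeasurable F -> cmeasurable (fun
    p => (F p)^*).
Proof.
move=> [F1 F2]; split.
  by rewrite (_ : (fun p => _) = fun p => Re (F p))//; apply/funext => p; case: (F p).
rewrite (_ : (fun p => _) = fun p => - Im (F p)); last by apply/funext => p; case: (F p).
exact: measurableT_comp.
Qed.

Lemma cmeasurableX (R : realType) (F : R * R -> R[i]) n : cmeasurable F -> cmeasurable (fun p
    => F p ^+ n).
Proof.
move=> mF; elim: n => [|n IH].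
  by under eq_fun do rewrite expr0; exact: cmeasurable_cst.
by under eq_fun do rewrite exprS; exact: cmeasurableM.
Qed.

Lemma cmeasurable_sum (R : realType) n (F : nat -> R * R -> R[i]) : (forall k, cmeasurable (F
    k)) ->
  cmeasurable (fun p => \sum_(0 <= k < n) F k p).
Proof.
move=> mF; split.
  by under eq_fun do rewrite Re_sum; apply: measurable_sum => k; have [] := mF k.
by under eq_fun do rewrite Im_sum; apply: measurable_sum => k; have [] := mF k.
Qed.

Lemma disc_Rintegral_rot (R : realType) (c s : R) (f : R * R -> R) :
  c ^+ 2 + s ^+ 2 = 1 -> c != -1 -> measurable_fun setT f -> disc_Rintegrable f ->
  disc_Rintegral (fun p => f (rot c s p)) = disc_Rintegral f.
Proof.
move=> cs1 cN1 mf fi.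
pose g (p : measurableTypeR R * measurableTypeR R) : measurableTypeR R * measurableTypeR R :=
    rot c s p.
have mg : measurable_fun setT g by exact: measurable_rot.
have mD := @measurable_disc2 R.
have DE : g @^-1` (@disc2 R) = @disc2 R.
  apply/seteqP; split => p; rewrite /g /disc2 /=.
    by rewrite -[X in X < _]/(sqmod (rot c s p)) sqmod_rot.
  by rewrite -[X in _ -> X < _]/(sqmod (rot c s p)) sqmod_rot.
have mE A : measurable A -> pushforward (@leb2 R) g A = leb2 A.
  by move=> mA; exact: leb2_rot.
have mf' : measurable_fun setT (EFin \o f) by apply/measurable_EFinP.
have E1 : (\int[pushforward (@leb2 R) g]_(p in @disc2 R) (f p)%:E = \int[@leb2 R]_(p in @disc2
    R) (f p)%:E)%E.
  by apply: eq_measure_integral => A mA _; exact: mE.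
have fi' : (pushforward (@leb2 R) g).-integrable (@disc2 R) (EFin \o f).
  apply/integrableP; split; first exact: measurable_funTS.
  have /integrableP[_] := fi; apply: le_lt_trans.
  rewrite le_eqVlt; apply/orP; left; apply/eqP.
  by apply: eq_measure_integral => A mA _; exact: mE.
(* The change of variables for a signed integrand asks for integrability of the composite; it comes
   from the nonnegative version applied to |f|. *)
have fg : (@leb2 R).-integrable (g @^-1` (@disc2 R)) ((EFin \o f) \o g).
  have /integrableP[_ H] := fi'.
  apply/integrableP; split.
    by rewrite DE; apply: measurable_funTS; apply: measurableT_comp.
  have mf'' : measurable_fun (@disc2 R) (fun p => `|(f p)%:E|%E).
    by apply: measurable_funTS; exact: measurableT_comp.
  have E := @ge0_integral_pushforward _ _ _ _ R g mg (@leb2 R) (@disc2 R) (fun p => `|(f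
      p)%:E|%E) mD mf''.
  apply: le_lt_trans H; rewrite le_eqVlt; apply/orP; left; apply/eqP/esym.
  by apply: E => p _; exact: abse_ge0.
have := @integral_pushforward _ _ _ _ R g mg (@leb2 R) (@disc2 R) (EFin \o f) mf' fg mD.
rewrite DE [LHS]E1 => E2.
by rewrite /disc_Rintegral /Rintegral E2.
Qed.

Lemma toC_rot (R : realType) (c s : R) (p : R * R) : toC (rot c s p) = (c +i* s) * toC p.
Proof. by apply: complex_eqP; rewrite ?(ReM, ImM) /=; ring. Qed.

Lemma disc_integral_rot (R : realType) (h : R -> R) (c s : R) (F : R * R -> R[i]) :
  c ^+ 2 + s ^+ 2 = 1 -> c != -1 -> measurable_fun setT h -> cmeasurable F -> disc_integrable h
      F ->
  disc_integral h (fun p => F (rot c s p)) = disc_integral h F.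
Proof.
move=> cs1 cN1 mh [F1 F2] [i1 i2].
have mhs : measurable_fun setT (fun p : R * R => h (sqmod p)).
  by apply: measurableT_comp => //; exact: measurable_sqmod.
apply: complex_eqP => /=.
  rewrite -[RHS](disc_Rintegral_rot cs1 cN1)//; last exact: measurable_funM.
  by apply: eq_disc_Rintegral => p _; rewrite sqmod_rot.
rewrite -[RHS](disc_Rintegral_rot cs1 cN1)//; last exact: measurable_funM.
by apply: eq_disc_Rintegral => p _; rewrite sqmod_rot.
Qed.

(** The integrand of <e_k, e_j>. *)
Definition monomial (R : realType) (k j : nat) (p : R * R) : R[i] := toC p ^+ k * (toC p ^+
    j)^*.

Lemma cmeasurable_monomial (R : realType) k j : cmeasurable (@monomial R k j).
Proof.
by apply: cmeasurableM; [|apply: cmeasurable_conjc]; apply: cmeasurableX; exact: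
    cmeasurable_toC.
Qed.

Lemma cabs_monomial (R : realType) k j (p : R * R) : cabs (monomial k j p) = cabs (toC p) ^+ (k
    + j).
Proof. by rewrite /monomial cabsM cabs_conjc !cabsX exprD. Qed.

Lemma cabs_toC_le1 (R : realType) (p : R * R) : disc2 p -> cabs (toC p) < 1.
Proof.
by move=> Dp; rewrite /cabs -[ltRHS]sqrtr1 ltr_sqrt.
Qed.

Lemma moivre (R : realType) (t : R) n : (cos t +i* sin t) ^+ n = cos (t *+ n) +i* sin (t *+ n).
Proof.
elim: n => [|n IH]; first by rewrite expr0 mulr0n cos0 sin0.
rewrite exprS IH mulrS; apply: complex_eqP; rewrite ?(ReM, ImM) /=.
  by rewrite cosD.
by rewrite sinD; ring.
Qed.

(* The angle pi / (2 |k - j|) turns z^k conj(z)^j by a quarter turn. *)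
Lemma rot_not_fixing (R : realType) k j : k != j ->
  exists c s : R, [/\ c ^+ 2 + s ^+ 2 = 1, c != -1 & (c +i* s) ^+ k * ((c +i* s) ^+ j)^* != 1].
Proof.
wlog kj : k j / (j < k)%N.
  (* Exchanging k and j conjugates the factor, and conjugation fixes 1. *)
  move=> H; rewrite neq_ltn => /orP[kj|kj]; last by apply: H => //; rewrite gtn_eqF.
  have [|c [s [h1 h2 h3]]] := H j k kj; first by rewrite gtn_eqF.
  exists c, s; split => //; apply: contra h3 => /eqP h3.
  by rewrite -[X in X * _]conjcK -rmorphM mulrC/= h3 conjc1.
move=> _; pose d := (k - j)%N; have d0 : (0 < d)%N by rewrite subn_gt0.
pose t : R := pi / 2 / d%:R.
have dR : 0 < d%:R :> R by rewrite ltr0n.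
have td : t *+ d = pi / 2 by rewrite -[LHS]mulr_natr divfK// gt_eqF.
exists (cos t), (sin t); split; first exact: cos2Dsin2.
  (* The angle is at most pi / 2, so its cosine is nonnegative and differs from -1. *)
  have t0 : 0 <= t by rewrite divr_ge0 ?ltW// divr_gt0 ?pi_gt0.
  have tpi : t <= pi / 2.
    rewrite ler_pdivrMr// ler_peMr ?ler1n//.
    by rewrite ltW// divr_gt0 ?pi_gt0.
  have : 0 <= cos t.
    apply: cos_ge0_pihalf; apply/andP; split => //.
    by rewrite (le_trans _ t0)// oppr_le0 ltW// divr_gt0 ?pi_gt0.
  by move=> c0; rewrite gt_eqF// (lt_le_trans _ c0)// ltrN10.
have -> : k = (d + j)%N by rewrite subnK// ltnW.
rewrite exprD -mulrA mulc_conjc cabsX.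
have -> : cabs (cos t +i* sin t) = 1 by rewrite /cabs /= cos2Dsin2 sqrtr1.
rewrite !expr1n mulr1 moivre td cos_pihalf sin_pihalf.
by apply/eqP => -[/eqP]; rewrite eq_sym oner_eq0.
Qed.

(** Some rotation multiplies the integrand by a constant u other than 1 and preserves the integral
    I, so I = u I. *)
Lemma disc_integral_monomial_ortho (R : realType) (h : R -> R) k j : k != j -> measurable_fun
    setT h ->
  disc_integrable h (monomial k j) -> disc_integral h (monomial k j) = 0.
Proof.
move=> /(rot_not_fixing R)[c [s [cs1 cN1 u1]]] mh hi.
set u := _ * _ in u1.
have := disc_integral_rot cs1 cN1 mh (@cmeasurable_monomial R k j) hi.
have -> : (fun p => monomial k j (rot c s p)) = fun p => u * monomial k j p.
  by apply/funext => p; rewrite /monomial toC_rot !exprMn rmorphM/= mulrACA.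
rewrite (disc_integral_scale u hi).2 => /eqP; rewrite -subr_eq0 -{2}[disc_integral h _]mul1r
    -mulrBl mulf_eq0.
by rewrite subr_eq0 (negbTE u1) => /eqP.
Qed.

Lemma disc_integral_monomial_diag (R : realType) (h : R -> R) j :
  disc_integral h (monomial j j) = (disc_Rintegral (fun p => sqmod p ^+ j * h (sqmod p)))%:C.
Proof.
have E (p : R * R) : monomial j j p = (sqmod p ^+ j)%:C.
  by rewrite /monomial mulc_conjc cabsX exprAC cabs_toC.
apply: complex_eqP => /=; first by apply: eq_disc_Rintegral => p _; rewrite E.
under eq_disc_Rintegral => p _ do rewrite E /= mul0r.
by rewrite /disc_Rintegral /Rintegral integral0.
Qed.

Definition radial_weight (R : realType) (h : R -> R) : Prop :=
  [/\ measurable_fun setT h, (forall s, 0 <= s < 1 -> 0 <= h s) &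
      disc_Rintegrable (fun p : R * R => h (sqmod p))].

Lemma disc_integral_bounded (R : realType) (h : R -> R) (F : R * R -> R[i]) (M : R) :
  radial_weight h -> cmeasurable F -> (forall p, disc2 p -> cabs (F p) <= M) -> disc_integrable
      h F.
Proof.
move=> [mh h0 hi] [F1 F2] FM.
have mhs : measurable_fun setT (fun p : R * R => h (sqmod p)).
  by apply: measurableT_comp => //; exact: measurable_sqmod.
have hM : disc_Rintegrable (fun p : R * R => M * h (sqmod p)).
  have [H _] := disc_Rintegral_lin M 0 hi hi.
  by apply: eq_disc_Rintegrable H => p _; rewrite mul0r addr0.
have hp (p : R * R) : disc2 p -> 0 <= h (sqmod p).
  by move=> Dp; apply: h0; rewrite sqmod_ge0.
split; apply: disc_Rintegrable_le hM.
- by apply: measurable_funTS; exact: measurable_funM.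
- move=> p Dp; rewrite normrM (ger0_norm (hp p Dp)) ler_wpM2r ?hp//.
  exact: le_trans (normr_Re_le _) (FM p Dp).
- by apply: measurable_funTS; exact: measurable_funM.
- move=> p Dp; rewrite normrM (ger0_norm (hp p Dp)) ler_wpM2r ?hp//.
  exact: le_trans (normr_Im_le _) (FM p Dp).
Qed.

Lemma disc_integral_monomial (R : realType) (h : R -> R) k j : radial_weight h ->
    disc_integrable h (monomial k j).
Proof.
move=> rh; apply: (disc_integral_bounded (M := 1) rh); first exact: cmeasurable_monomial.
move=> p Dp; rewrite cabs_monomial exprn_ile1 ?cabs_ge0//.
by rewrite ltW// cabs_toC_le1.
Qed.
(* Restricting the weight to |z|^2 < r < 1 keeps the partial sums of a power
   series uniformly bounded, which is what dominated convergence needs. *)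
Definition truncate (R : realType) (h : R -> R) (r s : R) : R := h s * (s < r)%R%:R.

Lemma measurable_lt (R : realType) (r : R) : measurable_fun setT (fun s : R => (s < r)%R%:R :
    R).
Proof.
rewrite (_ : (fun s => _) = \1_(`]-oo, r[%classic : set R)).
  exact: measurable_indic.
by apply/funext => s; rewrite indicE; congr (nat_of_bool _)%:R; rewrite mem_setE in_itv.
Qed.

Lemma radial_weight_truncate (R : realType) (h : R -> R) (r : R) : radial_weight h ->
    radial_weight (truncate h r).
Proof.
move=> [mh h0 hi].
have mt : measurable_fun setT (truncate h r) by apply: measurable_funM => //; exact:
    measurable_lt.
have t0 s : 0 <= s < 1 -> 0 <= truncate h r s by move=> s01; rewrite mulr_ge0// h0.
split => //; apply: disc_Rintegrable_le hi.
  apply: measurable_funTS; apply: measurableT_comp => //; exact: measurable_sqmod.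
move=> p Dp; rewrite ger0_norm; last by rewrite t0// sqmod_ge0.
by rewrite /truncate ler_piMr ?h0 ?sqmod_ge0//; case: (_ < _).
Qed.

(** * Integrating power series against monomials *)

Definition power_series (R : realType) (a : nat -> R[i]) (g : R[i] -> R[i]) : Prop :=
  forall z, z \in @cdisc R ->
  (Re (\sum_(0 <= k < n) a k * z ^+ k) @[n --> \oo] --> Re (g z)) /\
  (Im (\sum_(0 <= k < n) a k * z ^+ k) @[n --> \oo] --> Im (g z)).

Lemma cvgM_parts (R : realType) (u : nat -> R[i]) (l c : R[i]) :
  Re (u n) @[n --> \oo] --> Re l -> Im (u n) @[n --> \oo] --> Im l ->
  (Re (u n * c) @[n --> \oo] --> Re (l * c)) /\ (Im (u n * c) @[n --> \oo] --> Im (l * c)).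
Proof.
move=> uR uI; split.
  under eq_fun do rewrite ReM; rewrite ReM.
  by apply: cvgB; apply: cvgM => //; exact: cvg_cst.
under eq_fun do rewrite ImM; rewrite ImM.
by apply: cvgD; apply: cvgM => //; exact: cvg_cst.
Qed.

Lemma power_seriesZ (R : realType) (a : nat -> R[i]) (g : R[i] -> R[i]) (c : R[i]) :
  power_series a g -> power_series (fun k => a k * c) (fun z => g z * c).
Proof.
move=> ag z /ag[cR cIm]; have := cvgM_parts c cR cIm.
suff E n : (\sum_(0 <= k < n) a k * z ^+ k) * c = \sum_(0 <= k < n) a k * c * z ^+ k.
  by move=> [h1 h2]; split; [move: h1|move: h2]; under eq_fun do rewrite E.
by rewrite mulr_suml; apply: eq_bigr => k _; rewrite mulrAC.
Qed.

Lemma toC_cdisc (R : realType) (p : R * R) : disc2 p -> toC p \in @cdisc R.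
Proof. by move=> Dp; rewrite inE /cdisc /=; exact: cabs_toC_le1. Qed.

(** The terms of the series at the point t of the disc are bounded because it converges there; real
    and imaginary parts are bounded separately. *)
Lemma power_series_coef_bound (R : realType) (a : nat -> R[i]) (g : R[i] -> R[i]) (t : R) :
  power_series a g -> 0 < t < 1 -> exists M, forall k, cabs (a k) * t ^+ k <= M.
Proof.
move=> ag /andP[t0 t1].
have tD : t%:C \in @cdisc R by rewrite inE /cdisc /= cabs_real// ltW.
have [cR cIm] := ag _ tD.
have bR : exists M, forall k, `|Re (a k * t%:C ^+ k)| <= M.
  have : cvgn (series (fun k => Re (a k * t%:C ^+ k))).
    apply/cvg_ex; exists (Re (g t%:C)); move: cR.
    by under eq_fun do rewrite Re_sum.
  move=> /cvg_series_bounded[M [_ HM]]; exists (M + 1) => k.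
  by apply: HM => //; rewrite ltrDl.
have bI : exists M, forall k, `|Im (a k * t%:C ^+ k)| <= M.
  have : cvgn (series (fun k => Im (a k * t%:C ^+ k))).
    apply/cvg_ex; exists (Im (g t%:C)); move: cIm.
    by under eq_fun do rewrite Im_sum.
  move=> /cvg_series_bounded[M [_ HM]]; exists (M + 1) => k.
  by apply: HM => //; rewrite ltrDl.
have [M1 h1] := bR; have [M2 h2] := bI.
exists (M1 + M2) => k.
rewrite -[t in X in X <= _](cabs_real (ltW t0)) -cabsX -cabsM.
by rewrite (le_trans (cabs_le _))// lerD.
Qed.

Lemma geometric_sum_le (R : realType) (t : R) n : 0 < t < 1 ->
  \sum_(0 <= k < n) t ^+ k <= (1 - t)^-1.
Proof.
move=> /andP[t0 t1]; have s0 : 0 < 1 - t by rewrite subr_gt0.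
have E : (1 - t) * (\sum_(0 <= k < n) t ^+ k) = 1 - t ^+ n.
  elim: n => [|n IH]; first by rewrite big_nil mulr0 expr0 subrr.
  by rewrite big_nat_recr//= mulrDr IH exprS; ring.
by rewrite -[leRHS]mul1r ler_pdivlMr// mulrC E gerBl exprn_ge0// ltW.
Qed.

Lemma cabs_sum (R : realType) n (F : nat -> R[i]) :
  cabs (\sum_(0 <= k < n) F k) <= \sum_(0 <= k < n) cabs (F k).
Proof.
elim: n => [|n IH]; first by rewrite !big_nil cabs0.
by rewrite !big_nat_recr//= (le_trans (cabsD _ _))// lerD2r.
Qed.

Definition partial_sum (R : realType) (a : nat -> R[i]) n (p : R * R) : R[i] :=
  \sum_(0 <= k < n) a k * toC p ^+ k.

Lemma cmeasurable_partial_sum (R : realType) (a : nat -> R[i]) n : cmeasurable (partial_sum a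
    n).
Proof.
apply: cmeasurable_sum => k; apply: cmeasurableM; first exact: cmeasurable_cst.
by apply: cmeasurableX; exact: cmeasurable_toC.
Qed.

(* Coefficients are controlled at the radius t, so |z| < t^2 leaves a geometric
   series of ratio t. *)
Lemma partial_sum_bounded (R : realType) (a : nat -> R[i]) (g : R[i] -> R[i]) (t : R) :
  power_series a g -> 0 < t < 1 ->
  exists M, forall n (p : R * R), sqmod p < t ^+ 4 -> cabs (partial_sum a n p) <= M.
Proof.
move=> ag t01; have [M HM] := power_series_coef_bound ag t01.
have /andP[t0 t1] := t01.
have M0 : 0 <= M by apply: le_trans (HM 0); rewrite mulr_ge0 ?cabs_ge0// exprn_ge0// ltW.
exists (M * (1 - t)^-1) => n p pt.
have zt : cabs (toC p) <= t ^+ 2.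
  rewrite ltW// -(ltr_pXn2r (n := 2))// ?nnegrE ?cabs_ge0 ?exprn_ge0 ?ltW//.
  by rewrite cabs_toC -exprM.
rewrite (le_trans (cabs_sum _ _))//.
apply: (@le_trans _ _ (\sum_(0 <= k < n) M * t ^+ k)); last first.
  by rewrite -mulr_sumr ler_wpM2l// geometric_sum_le.
apply: ler_sum => k _; rewrite cabsM cabsX.
apply: (@le_trans _ _ (cabs (a k) * (t ^+ 2) ^+ k)).
  by rewrite ler_wpM2l ?cabs_ge0// lerXn2r// ?nnegrE ?cabs_ge0// exprn_ge0// ltW.
by rewrite -exprM mulnC exprM expr2 mulrA ler_wpM2r ?HM// exprn_ge0// ltW.
Qed.

(** The expected value of <z^i g, z^j> for g with coefficients a. The test is essential: for i > j
    the truncated subtraction j - i would wrongly select a 0. *)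
Definition coef_value (R : realType) (h : R -> R) (a : nat -> R[i]) i j : R[i] :=
  if (i <= j)%N then a (j - i)%N * (disc_Rintegral (fun p : R * R => sqmod p ^+ j * h (sqmod
      p)))%:C else 0.

(** By orthogonality at most the term k = j - i survives, and j < n puts it within the range of
    summation; the value therefore no longer depends on n. *)
Lemma disc_integral_partial_sum (R : realType) (h : R -> R) (a : nat -> R[i]) i j n :
    radial_weight h -> (j < n)%N ->
  disc_integral h (fun p => partial_sum a n p * monomial i j p) = coef_value h a i j.
Proof.
move=> rh jn; have [mh _ _] := rh.
have E (p : R * R) : partial_sum a n p * monomial i j p = \sum_(0 <= k < n) a k * monomial (k +
    i) j p.
  by rewrite /partial_sum mulr_suml; apply: eq_bigr => k _; rewrite /monomial exprD !mulrA.
have S k := disc_integral_scale (a k) (disc_integral_monomial (k + i) j rh).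
rewrite (eq_disc_integral _ (fun p _ => E p)) (disc_integral_sum n (fun k => (S k).1)).2.
under eq_bigr do rewrite (S _).2.
rewrite /coef_value; case: leqP => ij.
  rewrite (bigD1_seq (j - i)%N) ?iota_uniq ?mem_index_iota ?(leq_ltn_trans (leq_subr _ _))//=.
  rewrite subnK// disc_integral_monomial_diag big1 ?addr0// => k kj.
  rewrite disc_integral_monomial_ortho ?mulr0//; last exact: disc_integral_monomial.
  by apply: contra kj => /eqP <-; rewrite addnK.
rewrite big1// => k _; rewrite disc_integral_monomial_ortho ?mulr0//; last exact:
    disc_integral_monomial.
by rewrite gtn_eqF// ltn_addl.
Qed.

(** Where the cut-off weight is nonzero the partial sums have a common bound, so dominated
    convergence applies with a constant. The integrals are constant once n > j, which identifies
    their limit. *)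
Lemma disc_integral_truncate_coef (R : realType) (h : R -> R) (a : nat -> R[i]) (g : R[i] ->
    R[i]) i j (t : R) :
  radial_weight h -> power_series a g -> 0 < t < 1 ->
  disc_integral (truncate h (t ^+ 4)) (fun p => g (toC p) * monomial i j p) = coef_value
      (truncate h (t ^+ 4)) a i j.
Proof.
move=> rh ag t01; have rt := radial_weight_truncate (t ^+ 4) rh; have [mt t0 ti] := rt.
have [M HM] := partial_sum_bounded ag t01.
pose F n p := partial_sum a n p * monomial i j p.
have parts p : disc2 p -> (Re (F n p) @[n --> \oo] --> Re (g (toC p) * monomial i j p)) /\
   (Im (F n p) @[n --> \oo] --> Im (g (toC p) * monomial i j p)).
  by move=> Dp; have [cR cIm] := ag _ (toC_cdisc Dp); exact: cvgM_parts.
have mF n : cmeasurable (F n) by apply: cmeasurableM; [exact: cmeasurable_partial_sum|exact: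
    cmeasurable_monomial].
have [|||||_ LR LI] := @disc_integral_dominated R (truncate h (t ^+ 4)) F (fun p => g (toC p) *
    monomial i j p) (fun=> M) mt t0.
- by move=> n; have [m1 m2] := mF n; split; exact: measurable_funTS.
- by move=> p /parts[].
- by move=> p /parts[].
- move=> n p Dp; rewrite /truncate; case: ltP => pt; last by rewrite !mulr0.
  rewrite mulr1; apply: ler_wpM2r; first by have [_ h0 _] := rh; rewrite h0// sqmod_ge0.
  rewrite /F cabsM (le_trans _ (HM n p pt))// ler_piMr ?cabs_ge0// cabs_monomial.
  by rewrite exprn_ile1 ?cabs_ge0// ltW// cabs_toC_le1.
- have [H _] := disc_Rintegral_lin M 0 ti ti.
  by apply: eq_disc_Rintegrable H => p _; rewrite mul0r addr0.
have ev : \forall n \near \oo, disc_integral (truncate h (t ^+ 4)) (F n) = coef_value (truncate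
    h (t ^+ 4)) a i j.
  by near=> n; apply: disc_integral_partial_sum => //; near: n; exact: nbhs_infty_gt.
apply: complex_eqP.
  apply: (cvg_unique _ LR) => //; apply: cvg_near_cst.
  by move: ev; apply: filterS => n ->.
apply: (cvg_unique _ LI) => //; apply: cvg_near_cst.
by move: ev; apply: filterS => n ->.
Unshelve. all: by end_near. Qed.

Lemma disc_integral_truncate_lim (R : realType) (h : R -> R) (F : R * R -> R[i]) (G : R * R ->
    R) (r : nat -> R) :
  radial_weight h ->
  measurable_fun (@disc2 R) (fun p => Re (F p)) -> measurable_fun (@disc2 R) (fun p => Im (F
      p)) ->
  (forall p, disc2 p -> cabs (F p) <= G p) -> disc_Rintegrable (fun p => G p * h (sqmod p)) ->
  r n @[n --> \oo] --> (1 : R) ->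
  [/\ disc_integrable h F, Re (disc_integral (truncate h (r n)) F) @[n --> \oo] --> Re
      (disc_integral h F) &
    Im (disc_integral (truncate h (r n)) F) @[n --> \oo] --> Im (disc_integral h F)].
Proof.
move=> [mh h0 hi] mFR mFI FG iG cr.
(* Moving the cutoff from the weight to the integrand turns a limit of weights into a limit of
   functions; each point of the open disc eventually satisfies |z|^2 < r n. *)
pose F_ n (p : R * R) : R[i] := ((sqmod p < r n)%R%:R)%:C * F p.
have E n : disc_integral (truncate h (r n)) F = disc_integral h (F_ n).
  by apply: complex_eqP => /=; apply: eq_disc_Rintegral => p _; rewrite /F_ ?(ReM, ImM)
      /truncate /=; ring.
have ev p : disc2 p -> \forall n \near \oo, F_ n p = F p.
  move=> Dp; have Dp' : sqmod p < 1 by [].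
  have H0 : \forall n \near \oo, sqmod p < r n by exact: (cvgr_gt _ cr).
  move: H0; apply: filterS => n H.
  by rewrite /F_ H mul1r.
have ml n : measurable_fun (@disc2 R) (fun p : R * R => (sqmod p < r n)%R%:R : R).
  apply: measurable_funTS; apply: (measurableT_comp (measurable_lt (r n))); exact:
      measurable_sqmod.
have [|||||i1 LR LI] := @disc_integral_dominated R h F_ F G mh h0.
- move=> n; split.
    rewrite (_ : (fun p => _) = fun p => (sqmod p < r n)%R%:R * Re (F p)); first exact:
        measurable_funM.
    by apply/funext => p; rewrite /F_ ReM /= mul0r subr0.
  rewrite (_ : (fun p => _) = fun p => (sqmod p < r n)%R%:R * Im (F p)); first exact:
      measurable_funM.
  by apply/funext => p; rewrite /F_ ImM /= mul0r addr0.
- by move=> p /ev H; apply: cvg_near_cst; move: H; apply: filterS => n ->.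
- by move=> p /ev H; apply: cvg_near_cst; move: H; apply: filterS => n ->.
- move=> n p Dp; apply: ler_wpM2r; first by rewrite h0// sqmod_ge0.
  rewrite /F_ cabsM cabs_real ?ler0n//; case: (_ < _); rewrite ?mul1r ?mul0r ?FG//.
  by rewrite (le_trans _ (FG _ Dp))// cabs_ge0.
- exact: iG.
by split => //; under eq_fun do rewrite E.
Qed.

Lemma measurable_power_series (R : realType) (a : nat -> R[i]) (g : R[i] -> R[i]) :
  power_series a g ->
  measurable_fun (@disc2 R) (fun p => Re (g (toC p))) /\ measurable_fun (@disc2 R) (fun p => Im
      (g (toC p))).
Proof.
move=> ag; split.
  apply: (@measurable_fun_cvg _ _ R (@disc2 R) (fun n p => Re (partial_sum a n p))).
    by move=> n; apply: measurable_funTS; have [] := cmeasurable_partial_sum a n.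
  by move=> p Dp; have [] := ag _ (toC_cdisc Dp).
apply: (@measurable_fun_cvg _ _ R (@disc2 R) (fun n p => Im (partial_sum a n p))).
  by move=> n; apply: measurable_funTS; have [] := cmeasurable_partial_sum a n.
by move=> p Dp; have [] := ag _ (toC_cdisc Dp).
Qed.

Lemma disc_integral_coef (R : realType) (h : R -> R) (a : nat -> R[i]) (g : R[i] -> R[i]) i j :
  radial_weight h -> power_series a g ->
  (\int[@leb2 R]_(p in @disc2 R) ((cabs (g (toC p) * toC p ^+ i)) ^+ 2 * h (sqmod p))%:E <
      +oo)%E ->
  disc_integrable h (fun p => g (toC p) * monomial i j p) /\
  disc_integral h (fun p => g (toC p) * monomial i j p) = coef_value h a i j.
Proof.
move=> rh ag fin; have [mh h0 hi] := rh.
have [mgR mgI] := measurable_power_series ag.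
have hp (p : R * R) : disc2 p -> 0 <= h (sqmod p) by move=> Dp; rewrite h0// sqmod_ge0.
have [mi1 mi2] := @cmeasurable_monomial R i j.
have mFR : measurable_fun (@disc2 R) (fun p => Re (g (toC p) * monomial i j p)).
  under eq_fun do rewrite ReM.
  by apply: measurable_funB; apply: measurable_funM => //; exact: measurable_funTS.
have mFI : measurable_fun (@disc2 R) (fun p => Im (g (toC p) * monomial i j p)).
  under eq_fun do rewrite ImM.
  by apply: measurable_funD; apply: measurable_funM => //; exact: measurable_funTS.
pose Q (p : R * R) := cabs (g (toC p) * toC p ^+ i) ^+ 2.
have mhD : measurable_fun (@disc2 R) (fun p : R * R => h (sqmod p)).
  apply: measurable_funTS; apply: measurableT_comp => //; exact: measurable_sqmod.
have mQ : measurable_fun (@disc2 R) Q.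
  have [mc1 mc2] := cmeasurableX i (@cmeasurable_toC R).
  rewrite /Q; under eq_fun do rewrite sqr_cabs ReM ImM.
  apply: measurable_funD; apply: measurable_funX; [apply: measurable_funB|apply:
      measurable_funD];
    by apply: measurable_funM => //; exact: measurable_funTS.
have iQ : disc_Rintegrable (fun p => Q p * h (sqmod p)).
  apply/integrableP; split; first by apply/measurable_EFinP; exact: measurable_funM.
  apply: le_lt_trans fin; rewrite le_eqVlt; apply/orP; left; apply/eqP.
  apply: eq_integral => p /set_mem Dp; rewrite /= ger0_norm// mulr_ge0 ?hp//.
  by rewrite exprn_ge0// cabs_ge0.
(* The inequality x <= 1 + x^2 trades the modulus for its square, whose integral is finite by
   hypothesis; the weight has finite mass, so 1 is integrable too. *)
pose G (p : R * R) := 1 + Q p.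
have iG : disc_Rintegrable (fun p => G p * h (sqmod p)).
  have [H _] := disc_Rintegral_lin 1 1 hi iQ.
  by apply: eq_disc_Rintegrable H => p _; rewrite /G; ring.
have FG (p : R * R) : disc2 p -> cabs (g (toC p) * monomial i j p) <= G p.
  move=> Dp; rewrite /monomial mulrA cabsM cabs_conjc cabsX.
  apply: (@le_trans _ _ (cabs (g (toC p) * toC p ^+ i))).
    by rewrite ler_piMr ?cabs_ge0// exprn_ile1 ?cabs_ge0// ltW// cabs_toC_le1.
  by rewrite /G /Q; move: (cabs _) => x; nra.
(* The fourth power matches the cutoffs t^4 for which the truncated integrals are known, with t = 1
   - 1/(n+3). *)
pose r n : R := (1 - n.+3%:R^-1) ^+ 4.
have cr : r n @[n --> \oo] --> (1 : R).
  have h4 : {for (1 : R), continuous (fun s : R => s ^+ 4)} by exact: exprn_continuous.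
  have cu : (1 - n.+3%:R^-1 : R) @[n --> \oo] --> (1 : R).
    by rewrite -[X in _ --> X]subr0; apply: cvgB; [exact: cvg_cst|exact: cvgn_inv_add3].
  rewrite -[X in _ --> X](expr1n R 4).
  exact: (cvg_comp _ (fun s : R => s ^+ 4) cu h4).
have [iF LR LI] := disc_integral_truncate_lim rh mFR mFI FG iG cr.
split => //.
have [d1 d2] := @cmeasurable_monomial R j j.
(* The truncated identity contains the truncated j-th moment on its right-hand side, so that moment
   has to converge as well. *)
have [||_ NR _] := @disc_integral_truncate_lim R h (monomial j j) (fun=> 1) r rh
    (measurable_funTS d1) (measurable_funTS d2) _ _ cr.
- by move=> p Dp; rewrite cabs_monomial exprn_ile1 ?cabs_ge0// ltW// cabs_toC_le1.
- by apply: eq_disc_Rintegrable hi => p _; rewrite mul1r.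
have t01 n : 0 < (1 - n.+3%:R^-1 : R) < 1.
  have : 0 < n.+3%:R^-1 :> R by rewrite invr_gt0.
  have : n.+3%:R^-1 <= 3^-1 :> R by rewrite lef_pV2 ?posrE// ler_nat.
  by move: (n.+3%:R^-1) => u h3 h5; apply/andP; split; lra.
have E n : disc_integral (truncate h (r n)) (fun p => g (toC p) * monomial i j p) = coef_value
    (truncate h (r n)) a i j.
  exact: disc_integral_truncate_coef.
have NR' : disc_Rintegral (fun p : R * R => sqmod p ^+ j * truncate h (r n) (sqmod p)) @[n -->
    \oo]
   --> disc_Rintegral (fun p : R * R => sqmod p ^+ j * h (sqmod p)).
  have Ed : (fun n => Re (disc_integral (truncate h (r n)) (monomial j j))) =
      (fun n => disc_Rintegral (fun p : R * R => sqmod p ^+ j * truncate h (r n) (sqmod p))).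
    by apply/funext => n; rewrite disc_integral_monomial_diag.
  by move: NR; rewrite Ed disc_integral_monomial_diag.
pose m n : R := disc_Rintegral (fun p : R * R => sqmod p ^+ j * truncate h (r n) (sqmod p)).
apply: complex_eqP.
  apply: (cvg_unique _ LR) => //; rewrite /coef_value; case: leqP => ij.
    have -> : (fun n => Re (disc_integral (truncate h (r n)) (fun p => g (toC p) * monomial i j
        p))) =
        fun n => Re (a (j - i)%N) * m n.
      by apply/funext => n; rewrite E /coef_value ij ReM /= mulr0 subr0.
    by rewrite ReM /= mulr0 subr0; apply: cvgM => //; exact: cvg_cst.
  have -> : (fun n => Re (disc_integral (truncate h (r n)) (fun p => g (toC p) * monomial i j
      p))) = fun=> Re 0.
    by apply/funext => n; rewrite E /coef_value leqNgt ij.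
  exact: cvg_cst.
apply: (cvg_unique _ LI) => //; rewrite /coef_value; case: leqP => ij.
  have -> : (fun n => Im (disc_integral (truncate h (r n)) (fun p => g (toC p) * monomial i j
      p))) =
      fun n => Im (a (j - i)%N) * m n.
    by apply/funext => n; rewrite E /coef_value ij ImM /= mulr0 add0r.
  by rewrite ImM /= mulr0 add0r; apply: cvgM => //; exact: cvg_cst.
have -> : (fun n => Im (disc_integral (truncate h (r n)) (fun p => g (toC p) * monomial i j
    p))) = fun=> Im 0.
  by apply/funext => n; rewrite E /coef_value leqNgt ij.
exact: cvg_cst.
Qed.

(** * The weighted Bergman space *)

(** The density [wA] as a function of s = |z|^2; the two are convertible, so [binner] is a
    [disc_integral] by computation. *)
Definition bergman_weight (R : realType) (alpha s : R) : R := (alpha + 1) * (1 - s) `^ alpha /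
    pi.

Lemma measurable_bergman_weight (R : realType) (alpha : R) : measurable_fun setT
    (bergman_weight alpha).
Proof.
apply: measurable_funM => //; apply: measurable_funM => //.
apply: (measurableT_comp (measurable_powR alpha)).
by apply: measurable_funB.
Qed.

Lemma bergman_weight_ge0 (R : realType) (alpha s : R) : -1 < alpha -> 0 <= bergman_weight alpha
    s.
Proof.
move=> a1; rewrite /bergman_weight divr_ge0 ?pi_ge0// mulr_ge0 ?powR_ge0//.
by rewrite -lerBlDr sub0r ltW.
Qed.

Lemma bergman_weight_moment (R : realType) (alpha : R) j : -1 < alpha ->
  (\int[@leb2 R]_(p in @disc2 R) (sqmod p ^+ j * bergman_weight alpha (sqmod p))%:E
    = unit_area R * (((alpha + 1) / pi)%:E * beta_moment alpha j))%E.
Proof.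
move=> a1; pose k (s : R) := s ^+ j * bergman_weight alpha s.
have mk : measurable_fun setT k.
  by apply: measurable_funM; [exact: measurable_funX|exact: measurable_bergman_weight].
have k0 s : 0 <= s < 1 -> 0 <= k s.
  by move=> /andP[s0 _]; rewrite mulr_ge0 ?exprn_ge0// bergman_weight_ge0.
rewrite (integral_sqmod mk k0); congr (_ * _)%E.
(* The point 0 is null, so [0, 1[ may be replaced by ]0, 1[, the domain of [beta_moment]. *)
rewrite -integral_itv_obnd_cbnd; last by apply/measurable_EFinP; exact: measurable_funTS.
have c0 : 0 <= (alpha + 1) / pi :> R.
  by rewrite divr_ge0 ?pi_ge0// -lerBlDr sub0r ltW.
rewrite /beta_moment -ge0_integralZl//.
- by apply: eq_integral => s _; rewrite -EFinM; congr EFin; rewrite /k /bergman_weight; ring.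
- apply/measurable_EFinP; apply: measurable_funTS.
  apply: measurable_funM; first exact: measurable_funX.
  by apply: (measurableT_comp (measurable_powR alpha)); apply: measurable_funB.
- move=> s /=; rewrite in_itv/= => /andP[s0 _].
  by rewrite lee_fin mulr_ge0 ?powR_ge0// exprn_ge0// ltW.
Qed.

(** Packages the squared norms N_k by their positivity and recursion, so that the unevaluated area
    of the disc stays hidden in N. *)
Lemma bergman_weight_moments (R : realType) (alpha : R) : -1 < alpha ->
  exists N : nat -> R, [/\ forall j, 0 < N j,
   forall j, (\int[@leb2 R]_(p in @disc2 R) (sqmod p ^+ j * bergman_weight alpha (sqmod p))%:E
       = (N j)%:E)%E &
   forall k, k.+1%:R * N k = (k%:R + alpha + 2) * N k.+1].
Proof.
move=> a1.
have c0 : 0 < (alpha + 1) / pi :> R.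
  by rewrite divr_gt0 ?pi_gt0// -ltrBlDr sub0r.
have /andP[u0 uoo] := unit_area_bounds R.
have ufin : unit_area R \is a fin_num by rewrite ge0_fin_numE// ltW.
have u0' : 0 < fine (unit_area R) by rewrite fine_gt0// u0 uoo.
exists (fun j => fine (unit_area R) * ((alpha + 1) / pi * fine (beta_moment alpha j))).
split => [j|j|k].
- by have [r r0 ->] := beta_moment_fin j a1; rewrite mulr_gt0// mulr_gt0.
- rewrite bergman_weight_moment//; have [r r0 ->] := beta_moment_fin j a1.
  by rewrite !EFinM fineK.
have := beta_momentS k a1; have [r r0 ->] := beta_moment_fin k a1.
have [r' r0' ->] := beta_moment_fin k.+1 a1; rewrite -!EFinM => -[E] /=.
rewrite mulrCA [in LHS](mulrCA (k.+1%:R)) E; ring.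
Qed.

Lemma radial_weight_bergman_weight (R : realType) (alpha : R) : -1 < alpha -> radial_weight
    (bergman_weight alpha).
Proof.
move=> a1; split.
- exact: measurable_bergman_weight.
- by move=> s _; exact: bergman_weight_ge0.
have [N [N0 NE _]] := bergman_weight_moments a1.
apply/integrableP; split.
  apply/measurable_EFinP; apply: measurable_funTS.
  by apply: (measurableT_comp (measurable_bergman_weight alpha)); exact: measurable_sqmod.
apply: le_lt_trans (ltry (N 0)); rewrite -NE le_eqVlt; apply/orP; left; apply/eqP.
apply: eq_integral => p _; rewrite /= ger0_norm ?bergman_weight_ge0//.
by rewrite expr0 mul1r.
Qed.

(** The factor x produced by Gamma(x + 1) = x Gamma(x) is the one that the moment recursion absorbs
    in exchange for the next factor of the factorial. Cross-multiplication avoids dividing by a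
    value of Gamma. *)
Lemma moment_Gamma (R : realType) (alpha : R) (N : nat -> R) m : -1 < alpha ->
  (forall k, k.+1%:R * N k = (k%:R + alpha + 2) * N k.+1) ->
  N m.+1 * Gamma (m.+1%:R + alpha + 2) = N 1%N * (m.+1`!%:R * Gamma (alpha + 3)).
Proof.
move=> a1 NS; elim: m => [|m IH].
  have -> : 1`! = 1%N by [].
  by rewrite mul1r; congr (_ * Gamma _); ring.
have x0 : 0 < m.+1%:R + alpha + 2 by have := ler0n R m.+1; lra.
have -> : m.+2%:R + alpha + 2 = (m.+1%:R + alpha + 2) + 1 by rewrite -[m.+2%:R]natr1; ring.
rewrite (Gamma_add1 x0); have := NS m.+1 => E.
transitivity ((m.+1%:R + alpha + 2) * N m.+2 * Gamma (m.+1%:R + alpha + 2)); first by ring.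
by rewrite -E -mulrA IH [in RHS]factS natrM mulrCA !mulrA.
Qed.

(* Stated as an inequality because then no finiteness or positivity of [Gamma] is
   needed: a vanishing denominator makes the left-hand side 0. *)
Lemma sqrt_moment_ratio (R : realType) (alpha : R) (N : nat -> R) m : -1 < alpha -> (0 < m)%N ->
  (forall j, 0 < N j) ->
  (forall k, k.+1%:R * N k = (k%:R + alpha + 2) * N k.+1) ->
  Num.sqrt (m`!%:R * Gamma (alpha + 3) / Gamma (m%:R + alpha + 2)) <= Num.sqrt (N m / N 1%N).
Proof.
move=> a1; case: m => // m _ N0 NS; have E := moment_Gamma m a1 NS.
have [->|G0] := eqVneq (Gamma (m.+1%:R + alpha + 2)) 0.
  by rewrite invr0 mulr0 sqrtr0 sqrtr_ge0.
rewrite ler_wsqrtr// le_eqVlt; apply/orP; left; apply/eqP.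
by apply/(canLR (mulfK G0)); rewrite mulrAC E mulrAC divff ?gt_eqF// mul1r.
Qed.

Lemma binner_disc_integral (R : realType) (alpha : R) (f g : R[i] -> R[i]) :
  binner alpha f g = disc_integral (bergman_weight alpha) (fun p => f (toC p) * (g (toC p))^*).
Proof. by []. Qed.

Lemma sqnorm_int_disc_integral (R : realType) (alpha : R) (f : R[i] -> R[i]) :
  disc_integrable (bergman_weight alpha) (fun p => f (toC p) * (f (toC p))^*) ->
  sqnorm_int alpha f = (Re (disc_integral (bergman_weight alpha) (fun p => f (toC p) * (f (toC
      p))^*)))%:E.
Proof.
move=> [fi _]; rewrite /disc_integral /= /disc_Rintegral /Rintegral fineK; last first.
  by apply: integrable_fin_num; [exact: measurable_disc2|exact: fi].
by apply: eq_integral => p _; rewrite mulc_conjc.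
Qed.

(** Both <f, f> and <T f, f> expand into four products when f has two terms. *)
Lemma disc_integral_four (R : realType) (h : R -> R) (c1 c2 c3 c4 : R[i]) (F1 F2 F3 F4 : R * R
    -> R[i]) :
  disc_integrable h F1 -> disc_integrable h F2 -> disc_integrable h F3 -> disc_integrable h F4
      ->
  disc_integrable h (fun p => c1 * F1 p + (c2 * F2 p + (c3 * F3 p + c4 * F4 p))) /\
  disc_integral h (fun p => c1 * F1 p + (c2 * F2 p + (c3 * F3 p + c4 * F4 p))) =
  c1 * disc_integral h F1 + (c2 * disc_integral h F2 + (c3 * disc_integral h F3 + c4 *
      disc_integral h F4)).
Proof.
move=> i1 i2 i3 i4; have [s4 e4] := disc_integral_scale c4 i4.
have [s3 e3] := disc_integral_linear c3 i3 s4; have [s2 e2] := disc_integral_linear c2 i2 s3.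
by have [s1 e1] := disc_integral_linear c1 i1 s2; rewrite e1 e2 e3 e4.
Qed.

(** * The operator on combinations of two monomials *)

Definition two_term (R : realType) m (A B : R[i]) (z : R[i]) : R[i] := A * z + B * z ^+ m.

Lemma two_term_norm (R : realType) (alpha : R) m (A B : R[i]) (N : nat -> R) : -1 < alpha -> (1
    < m)%N ->
  (forall j, (\int[@leb2 R]_(p in @disc2 R) (sqmod p ^+ j * bergman_weight alpha (sqmod p))%:E
      = (N j)%:E)%E) ->
  sqnorm_int alpha (two_term m A B) = (cabs A ^+ 2 * N 1%N + cabs B ^+ 2 * N m)%:E.
Proof.
move=> a1 m1 NE; have rh := radial_weight_bergman_weight a1; have [mh _ _] := rh.
have im k j := disc_integral_monomial k j rh.
have [i4 e4] := disc_integral_four (A * A^*) (A * B^*) (B * A^*) (B * B^*) (im 1%N 1%N) (im 1%N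
    m) (im m 1%N) (im m m).
have E (p : R * R) : A * A^* * monomial 1 1 p + (A * B^* * monomial 1 m p + (B * A^* * monomial
    m 1 p + B * B^* * monomial m m p))
   = two_term m A B (toC p) * (two_term m A B (toC p))^*.
  by rewrite /two_term rmorphD /= !rmorphM /= /monomial !expr1; ring.
rewrite sqnorm_int_disc_integral; last by apply: eq_disc_integrable i4 => p _; rewrite E.
rewrite -(eq_disc_integral _ (fun p _ => E p)) e4 !disc_integral_monomial_diag.
rewrite (disc_integral_monomial_ortho _ mh (im 1%N m)) ?ltn_eqF// (disc_integral_monomial_ortho
    _ mh (im m 1%N)) ?gtn_eqF//.
have rN j : disc_Rintegral (fun p : R * R => sqmod p ^+ j * bergman_weight alpha (sqmod p)) = N
    j.
  by rewrite /disc_Rintegral /Rintegral NE.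
rewrite !rN !mulr0 !add0r !mulc_conjc -!rmorphM -rmorphD /=.
by [].
Qed.

Lemma derivable_binomial (K : numFieldType) m (A B z : K) :
  derivable ((fun z : K => A * z + B * z ^+ m) : K^o -> K^o) z 1.
Proof.
have dX : derivable ((fun z => z) ^+ m : K^o -> K^o) z 1 by exact: derivableX.
have d1 : derivable (A \*: ((fun z => z) : K^o -> K^o)) z 1 by exact: derivableZ.
have d2 : derivable (B \*: ((fun z => z) ^+ m : K^o -> K^o)) z 1 by exact: derivableZ.
have d3 := derivableD d1 d2.
set f := (X in derivable X) in d3.
have -> : (fun z : K => A * z + B * z ^+ m) = f.
  by apply/funext => u; rewrite /f !fctE.
exact: d3.
Qed.

Lemma two_term_bergman (R : realType) (alpha : R) m (A B : R[i]) : -1 < alpha -> (1 < m)%N ->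
  bergman alpha (two_term m A B).
Proof.
move=> a1 m1; split; last first.
  by have [N [_ NE _]] := bergman_weight_moments a1; rewrite (two_term_norm _ _ a1 m1 NE) ltry.
by move=> z _; exact: derivable_binomial.
Qed.

Lemma two_term_wcomp (R : realType) (alpha : R) (lam A B : R[i]) (psihat : nat -> R[i])
    (psi : R[i] -> R[i]) m (N : nat -> R) :
  -1 < alpha -> (1 < m)%N -> power_series psihat psi -> psihat 0%N = 0 ->
  (forall f, bergman alpha f -> bergman alpha (wcomp psi (fun z => lam * z) f)) ->
  (forall j, (\int[@leb2 R]_(p in @disc2 R) (sqmod p ^+ j * bergman_weight alpha (sqmod p))%:E
      = (N j)%:E)%E) ->
  binner alpha (wcomp psi (fun z => lam * z) (two_term m A B)) (two_term m A B)
    = A * B^* * (lam * psihat m.-1) * (N m)%:C.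
Proof.
move=> a1 m1 ag p0 bT NE; have rh := radial_weight_bergman_weight a1.
(* T e_1 and T e_m are square-integrable because e_1 and e_m are themselves two-term functions, with
   coefficients (1, 0) and (0, 1). *)
have fin i : i = 1%N \/ i = m ->
    (\int[@leb2 R]_(p in @disc2 R) ((cabs (psi (toC p) * lam ^+ i * toC p ^+ i)) ^+ 2 *
        bergman_weight alpha (sqmod p))%:E < +oo)%E.
  case=> ->.
    have [_] := bT _ (two_term_bergman 1 0 a1 m1); congr (_ < _)%E; apply: eq_integral => p _.
    by rewrite /wcomp /two_term; congr (cabs _ ^+ 2 * _)%:E; rewrite !expr1; ring.
  have [_] := bT _ (two_term_bergman 0 1 a1 m1); congr (_ < _)%E; apply: eq_integral => p _.
  by rewrite /wcomp /two_term; congr (cabs _ ^+ 2 * _)%:E; rewrite exprMn; ring.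
(* The constant lam^i from (lam z)^i is absorbed into the coefficients: T e_i = g z^i with g = lam^i
   psi. *)
have ci i j : i = 1%N \/ i = m -> _ := fun H => disc_integral_coef (i := i) j rh (power_seriesZ
    (lam ^+ i) ag) (fin i H).
have [i1 c1] := ci 1%N 1%N (or_introl erefl).
have [i2 c2] := ci 1%N m (or_introl erefl).
have [i3 c3] := ci m 1%N (or_intror erefl).
have [i4 c4] := ci m m (or_intror erefl).
have [_ e4] := disc_integral_four (A * A^*) (A * B^*) (B * A^*) (B * B^*) i1 i2 i3 i4.
rewrite binner_disc_integral.
transitivity (A * A^* * 0 + (A * B^* * (psihat m.-1 * lam * (N m)%:C) + (B * A^* * 0 + B * B^*
    * 0))); last by ring.
have rN j : disc_Rintegral (fun p : R * R => sqmod p ^+ j * bergman_weight alpha (sqmod p)) = N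
    j.
  by rewrite /disc_Rintegral /Rintegral NE.
(* The equal pairs select the coefficient of index 0, which vanishes; (m, 1) fails the test in
   [coef_value]; (1, m) selects index m - 1. *)
move: c1 c2 c3 c4; rewrite /coef_value !leqnn !subnn p0 !mul0r (ltnW m1) leqNgt m1 /= !rN subn1
    expr1.
move=> c1 c2 c3 c4; rewrite c1 c2 c3 c4 in e4; rewrite -e4; apply: eq_disc_integral => p _.
by rewrite /wcomp /two_term rmorphD /= !rmorphM /= /monomial !expr1 exprMn; ring.
Qed.

(** With a real, b is forced to be conj(z) / a, and x = a^2 must solve x (1 - x) = |z|^2, which has
    real roots exactly when |z| <= 1/2. *)
Lemma unit_pair (R : realType) (z : R[i]) : cabs z <= 2^-1 ->
  exists a b : R[i], cabs a ^+ 2 + cabs b ^+ 2 = 1 /\ a * b^* = z.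
Proof.
move=> z2; have c0 := cabs_ge0 z; set c := cabs z in z2 c0.
have d0 : 0 <= 1 - 4 * c ^+ 2 by nra.
pose s := Num.sqrt (1 - 4 * c ^+ 2).
have s0 : 0 <= s by exact: sqrtr_ge0.
have s2 : s ^+ 2 = 1 - 4 * c ^+ 2 by exact: sqr_sqrtr.
have q0 : 0 < (1 + s) / 2 by lra.
(* The larger root is taken: it is at least 1/2, so division by a is legitimate even when z = 0. *)
pose a := Num.sqrt ((1 + s) / 2).
have a0 : 0 < a by rewrite sqrtr_gt0.
have a2 : a ^+ 2 = (1 + s) / 2 by rewrite sqr_sqrtr// ltW.
exists a%:C, (z^* * (a^-1)%:C); split.
  rewrite cabsM cabs_conjc !cabs_real ?invr_ge0 ?(ltW a0)// -/c exprMn exprVn a2.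
  have -> : c ^+ 2 = (1 - s ^+ 2) / 4 by rewrite s2; field.
  by field; rewrite gt_eqF//; lra.
have key (x : R[i]) (t : R) : t != 0 -> t%:C * (x^* * (t^-1)%:C)^* = x.
  by case: x => x y t0; apply: complex_eqP => /=; field.
by apply: key; rewrite gt_eqF.
Qed.

Theorem theorem5p2 (R : realType) (alpha : R) (lam : R[i])
  (psihat : nat -> R[i]) (psi : R[i] -> R[i]) (m : nat) :
  -1 < alpha ->
  lam != 0 -> cabs lam <= 1 ->
  psihat 0%N = 0 ->
  (forall z, z \in (@cdisc R) ->
     series (fun k => (psihat k * z ^+ k : R[i]^o)) @ \oo --> (psi z : R[i]^o)) ->
  bounded_on_bergman alpha (wcomp psi (fun z => lam * z)) ->
  (2 <= m)%N ->
  [set w | cabs w <= 2^-1 * Num.sqrt (m`!%:R * Gamma (alpha + 3) / Gamma (m%:R + alpha + 2))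
                          * cabs (lam * psihat m.-1)]
    `<=` numrange alpha (wcomp psi (fun z => lam * z)).
Proof.
move=> a1 _ _ p0 ag [M bT] m2 w /= wle.
have [N [N0 NE NS]] := bergman_weight_moments a1.
have ps : power_series psihat psi by move=> z /ag /cvgC_parts.
have bT' f : bergman alpha f -> bergman alpha (wcomp psi (fun z => lam * z) f) by move=> /bT[].
have m0 : (0 < m)%N by exact: ltnW.
have s1 : 0 < Num.sqrt (N 1%N) by rewrite sqrtr_gt0.
have sm : 0 < Num.sqrt (N m) by rewrite sqrtr_gt0.
(* The quotient of the norms of e_m and e_1. *)
pose rho := Num.sqrt (N m) / Num.sqrt (N 1%N).
have rho0 : 0 < rho by rewrite divr_gt0.
have rle := sqrt_moment_ratio a1 m0 N0 NS.
have rhoE : Num.sqrt (N m / N 1%N) = rho by rewrite sqrtrM ?(ltW (N0 _))// sqrtrV ?(ltW (N0 _)).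
rewrite rhoE in rle.
set c := lam * psihat m.-1 in wle *.
have [zeta [z2 wE]] : exists zeta : R[i], cabs zeta <= 2^-1 /\ w = zeta * rho%:C * c.
  have wle' : cabs w <= 2^-1 * rho * cabs c.
    by rewrite (le_trans wle)// ler_wpM2r ?cabs_ge0// ler_wpM2l// invr_ge0.
  (* If c = 0 the disc is reduced to the origin; otherwise zeta is the quotient of w by rho c. *)
  have [c0|c0] := eqVneq c 0.
    exists 0; rewrite cabs0 invr_ge0 ler0n c0 mulr0; split => //.
    move: wle'; rewrite c0 cabs0 mulr0 => w0; apply: cabs_eq0.
    by apply/le_anti; rewrite w0 cabs_ge0.
  have rc0 : rho%:C * c != 0.
    by rewrite mulf_neq0// (inj_eq (@complexI R) rho 0) gt_eqF.
  exists (w / (rho%:C * c)); split; last by rewrite -mulrA mulfVK.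
  have rcp : 0 < cabs (rho%:C * c).
    by rewrite lt_neqAle cabs_ge0 andbT eq_sym; apply: contra rc0 => /eqP/cabs_eq0 ->.
  rewrite -(ler_pM2r rcp) -cabsM mulfVK// cabsM cabs_real ?(ltW rho0)// mulrA.
  exact: wle'.
have [a [b [ab1 abz]]] := unit_pair z2.
(* Dividing by the norms of e_1 and e_m turns the condition that f has norm 1 into |a|^2 + |b|^2 =
   1. *)
pose A : R[i] := a * ((Num.sqrt (N 1%N))^-1)%:C; pose B : R[i] := b * ((Num.sqrt (N m))^-1)%:C.
exists (two_term m A B); split; first exact: two_term_bergman.
split.
  rewrite /bnorm (two_term_norm _ _ a1 m2 NE) /= !cabsM !cabs_real ?invr_ge0 ?sqrtr_ge0//.
  have key (x : R) j : (x / Num.sqrt (N j)) ^+ 2 * N j = x ^+ 2.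
    by rewrite expr_div_n sqr_sqrtr ?ltW// divfK ?gt_eqF.
  rewrite !key.
  by rewrite ab1 sqrtr1.
rewrite (@two_term_wcomp R alpha lam A B psihat psi m N a1 m2 ps p0 bT' NE) -/c wE -abz.
have -> : A * B^* = A * (b^* * ((Num.sqrt (N m))^-1)%:C).
  by congr (A * _); rewrite /B; case: (b) => x y; apply: complex_eqP => /=; ring.
rewrite /A.
have -> : (N m)%:C = (Num.sqrt (N m))%:C * (Num.sqrt (N m))%:C by rewrite -rmorphM -expr2
    sqr_sqrtr// ltW.
rewrite /rho rmorphM /=.
have : (Num.sqrt (N m))%:C * ((Num.sqrt (N m))^-1)%:C = 1 by rewrite -rmorphM divff ?gt_eqF.
move: ((Num.sqrt (N m))%:C) (((Num.sqrt (N m))^-1)%:C) => x y xy.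
transitivity (a * b^* * (x * y) * x * ((Num.sqrt (N 1%N))^-1)%:C * c); first by ring.
by rewrite xy; ring.
Qed.
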